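(* Let $n\ge1$, $\sigma=\{\sigma_1,\dots,\sigma_n\}$, and let $\mathcal{G}$ be an algebraic group over a $\sigma$-field $k$. Let $(G_i)_{i\in\mathbb{N}}$ be a generalised $\sigma$-algebraic group with respect to $\mathcal{G}$. Then $$\mathbb{I}(G_{i+1})=\bigl(\mathbb{I}(G_i),\sigma_1(\mathbb{I}(G_i)),\dots,\sigma_n(\mathbb{I}(G_i))\bigr)$$ for all large enough $i\in\mathbb{N}$, where the right-hand side denotes the ideal of $k[\mathcal{G}[i+1]]$ generated by $\mathbb{I}(G_i)\cup\sigma_1(\mathbb{I}(G_i))\cup\dots\cup\sigma_n(\mathbb{I}(G_i))$.
   Context: All rings are commutative with unit; $\mathbb{N}=\{0,1,2,\dots\}$. A $\sigma$-field is a field $k$ with $n$ pairwise commuting ring endomorphisms $\sigma_1,\dots,\sigma_n\colon k\to k$. $T_\sigma$ is the free commutative monoid of formal monomials $\tau=\sigma_1^{k_1}\cdots\sigma_n^{k_n}$, acting on $k$; $\operatorname{ord}(\tau)=k_1+\dots+k_n$ and $T_\sigma[i]=\{\tau\in T_\sigma\mid\operatorname{ord}(\tau)\le i\}$. An algebraic group over $k$ is an affine group scheme of finite type over $k$, with coordinate ring $k[\mathcal{G}]$; closed subgroups $\mathcal{H}\le\mathcal{G}$ correspond to Hopf ideals $\mathbb{I}(\mathcal{H})\subseteq k[\mathcal{G}]$. For $\tau\in T_\sigma$, ${}^\tau\mathcal{G}$ is the base change of $\mathcal{G}$ along $\tau\colon k\to k$, with coordinate ring $k[\mathcal{G}]\otimes_kk$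 (formed via $\tau$ on the right factor; $k$-algebra via the right factor). Put $\mathcal{G}[i]=\prod_{\tau\in T_\sigma[i]}{}^\tau\mathcal{G}$, so $k[\mathcal{G}[i]]=\bigotimes_{\tau\in T_\sigma[i]}k[{}^\tau\mathcal{G}]$, with natural inclusions $k[\mathcal{G}[i]]\subseteq k[\mathcal{G}[i+1]]$ and union $k\{\mathcal{G}\}$. For each $j$, $\sigma_j\colon k\{\mathcal{G}\}\to k\{\mathcal{G}\}$ is the ring endomorphism sending $r\otimes\lambda$ in the $\tau$-factor to $r\otimes\sigma_j(\lambda)$ in the $\sigma_j\tau$-factor; it maps $k[\mathcal{G}[i]]$ into $k[\mathcal{G}[i+1]]$. A generalised $\sigma$-algebraic group with respect to $\mathcal{G}$ is a sequence $(G_i)_{i\in\mathbb{N}}$ such that: for every $i\in\mathbb{N}$, $G_i$ is a closed subgroup of $\mathcal{G}[i]$, defined by a Hopf ideal $\mathbb{I}(G_i)\subseteq k[\mathcal{G}[i]]$; and for every $i\ge1$, $\mathbb{I}(G_{i-1})\subseteq\mathbb{I}(G_i)$ and $\sigma_j(\mathbb{I}(G_{i-1}))\subseteq\mathbb{I}(G_i)$ for all $1\le j\le n$. *)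

(* Defs.v *)
From HB Require Import structures.
From mathcomp Require Import all_boot all_order all_algebra.
From mathcomp Require Import boolp classical_sets.
From mathcomp Require Import mpoly.

Set Implicit Arguments.
Unset Strict Implicit.
Unset Printing Implicit Defensive.

Import GRing.Theory.
Local Open Scope ring_scope.
Local Open Scope quotient_scope.

(* A commutative k-algebra is a commutative ring with a structure morphism    *)
(* from k. MathComp's comAlgType is not used: it excludes the zero ring (so   *)
(* tensor products could not be formed without a nontriviality proof), and    *)
(* base change puts several k-algebra structures on one and the same ring.    *)
Record algebra (k : comPzRingType) := Algebra {
  alg_ring :> comPzRingType;
  alg_map : {rmorphism k -> alg_ring} }.

Arguments alg_map {k} a.

Record alg_hom (k : comPzRingType) (A B : algebra k) := AlgHom {
  hom_fun :> {rmorphism A -> B};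
  hom_alg : forall c : k, hom_fun (alg_map A c) = alg_map B c }.

Definition base_algebra (k : comPzRingType) : algebra k :=
  @Algebra k k (idfun : {rmorphism k -> k}).

Definition restr_scalars (k k' : comPzRingType) (t : {rmorphism k -> k'})
    (A : algebra k') : algebra k :=
  @Algebra k A (alg_map A \o t : {rmorphism k -> A}).

Section HomConstructions.
Variables (k : comPzRingType).

Definition id_hom (A : algebra k) : alg_hom A A :=
  @AlgHom k A A (idfun : {rmorphism A -> A}) (fun=> erefl).

Lemma comp_hom_alg (A B C : algebra k) (g : alg_hom B C) (f : alg_hom A B) c :
  (g \o f) (alg_map A c) = alg_map C c.
Proof. by rewrite /= !hom_alg. Qed.

Definition comp_hom (A B C : algebra k) (g : alg_hom B C) (f : alg_hom A B) :
  alg_hom A C :=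
  @AlgHom k A C (g \o f : {rmorphism A -> C}) (comp_hom_alg g f).

(* The structure morphism k -> A. *)
Definition unit_hom (A : algebra k) : alg_hom (base_algebra k) A :=
  @AlgHom k (base_algebra k) A (alg_map A) (fun=> erefl).

End HomConstructions.

Definition restr_hom (k k' : comPzRingType) (t : {rmorphism k -> k'})
    (A B : algebra k') (f : alg_hom A B) :
    alg_hom (restr_scalars t A) (restr_scalars t B) :=
  @AlgHom k (restr_scalars t A) (restr_scalars t B) f (fun c => hom_alg f (t c)).

(* The tensor product over k of a family (A i)_(i : I) of commutative         *)
(* k-algebras, by generators and relations: the commutative ring generated by *)
(* the scalars c : k and the symbols "a in the i-th factor", subject to the   *)
(* relations making k and every A i map to it by compatible ring morphisms.   *)
(* [tens_lift], [tens_lift_in] and [tens_ext] below are its universal         *)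
(* property: it is the coproduct of the A i in commutative k-algebras. The     *)
(* pure tensor of (a i)_i is the product of the [tens_in i (a i)].            *)
Section TensorRing.
Variables (k : comPzRingType) (I : Type) (A : I -> algebra k).

Inductive texpr : Type :=
| TCst of k
| TGen i of A i
| TAdd of texpr & texpr
| TOpp of texpr
| TMul of texpr & texpr.

Inductive trel : texpr -> texpr -> Prop :=
| trel_refl x : trel x x
| trel_sym x y : trel x y -> trel y x
| trel_trans y x z : trel x y -> trel y z -> trel x z
| trel_add x x' y y' : trel x x' -> trel y y' -> trel (TAdd x y) (TAdd x' y')
| trel_opp x x' : trel x x' -> trel (TOpp x) (TOpp x')
| trel_mul x x' y y' : trel x x' -> trel y y' -> trel (TMul x y) (TMul x' y')
| trel_addA x y z : trel (TAdd x (TAdd y z)) (TAdd (TAdd x y) z)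
| trel_addC x y : trel (TAdd x y) (TAdd y x)
| trel_add0 x : trel (TAdd (TCst 0) x) x
| trel_addN x : trel (TAdd (TOpp x) x) (TCst 0)
| trel_mulA x y z : trel (TMul x (TMul y z)) (TMul (TMul x y) z)
| trel_mulC x y : trel (TMul x y) (TMul y x)
| trel_mul1 x : trel (TMul (TCst 1) x) x
| trel_mulDl x y z : trel (TMul (TAdd x y) z) (TAdd (TMul x z) (TMul y z))
| trel_cstD c d : trel (TCst (c + d)) (TAdd (TCst c) (TCst d))
| trel_cstM c d : trel (TCst (c * d)) (TMul (TCst c) (TCst d))
| trel_genD i (a b : A i) : trel (TGen (a + b)) (TAdd (TGen a) (TGen b))
| trel_genM i (a b : A i) : trel (TGen (a * b)) (TMul (TGen a) (TGen b))
| trel_genC i c : trel (TGen (alg_map (A i) c)) (TCst c).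

HB.instance Definition _ := gen_eqMixin texpr.
HB.instance Definition _ := gen_choiceMixin texpr.

Definition trelb (x y : texpr) : bool := `[< trel x y >].

Lemma trelb_refl : reflexive trelb.
Proof. by move=> x; apply/asboolP; exact: trel_refl. Qed.
Lemma trelb_sym : ssrbool.symmetric trelb.
Proof. by move=> x y; apply/asboolP/asboolP; exact: trel_sym. Qed.
Lemma trelb_trans : transitive trelb.
Proof.
by move=> y x z /asboolP xy /asboolP yz; apply/asboolP/(trel_trans xy yz).
Qed.

Canonical trel_equiv := EquivRel trelb trelb_refl trelb_sym trelb_trans.

Definition tens_ring : Type := {eq_quot trel_equiv}.

HB.instance Definition _ := Choice.on tens_ring.
HB.instance Definition _ := EqQuotient.on tens_ring.

Definition tens_class (x : texpr) : tens_ring := \pi_tens_ring x.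

Lemma tens_class_eq x y : tens_class x = tens_class y <-> trel x y.
Proof.
by split=> [/eqquotP/asboolP|xy] //; apply/eqquotP/asboolP.
Qed.

Lemma tens_class_repr (u : tens_ring) : tens_class (repr u) = u.
Proof. exact: reprK. Qed.

Lemma trel_repr x : trel (repr (tens_class x)) x.
Proof. by apply/tens_class_eq; rewrite tens_class_repr. Qed.

Definition tens_add (u v : tens_ring) := tens_class (TAdd (repr u) (repr v)).
Definition tens_opp (u : tens_ring) := tens_class (TOpp (repr u)).
Definition tens_mul (u v : tens_ring) := tens_class (TMul (repr u) (repr v)).

Lemma tens_addE x y : tens_add (tens_class x) (tens_class y) = tens_class (TAdd x y).
Proof. by apply/tens_class_eq; apply: trel_add; exact: trel_repr. Qed.
Lemma tens_oppE x : tens_opp (tens_class x) = tens_class (TOpp x).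
Proof. by apply/tens_class_eq; apply: trel_opp; exact: trel_repr. Qed.
Lemma tens_mulE x y : tens_mul (tens_class x) (tens_class y) = tens_class (TMul x y).
Proof. by apply/tens_class_eq; apply: trel_mul; exact: trel_repr. Qed.

Lemma tens_ind (P : tens_ring -> Prop) :
  (forall x, P (tens_class x)) -> forall u, P u.
Proof. by move=> Px u; rewrite -[u]tens_class_repr. Qed.

Lemma tens_addA : associative tens_add.
Proof.
elim/tens_ind=> x; elim/tens_ind=> y; elim/tens_ind=> z.
by rewrite !tens_addE; apply/tens_class_eq; exact: trel_addA.
Qed.
Lemma tens_addC : commutative tens_add.
Proof.
elim/tens_ind=> x; elim/tens_ind=> y.
by rewrite !tens_addE; apply/tens_class_eq; exact: trel_addC.
Qed.
Lemma tens_add0 : left_id (tens_class (TCst 0)) tens_add.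
Proof.
by elim/tens_ind=> x; rewrite !tens_addE; apply/tens_class_eq; exact: trel_add0.
Qed.
Lemma tens_addN : left_inverse (tens_class (TCst 0)) tens_opp tens_add.
Proof.
elim/tens_ind=> x; rewrite tens_oppE tens_addE; apply/tens_class_eq.
exact: trel_addN.
Qed.
Lemma tens_mulA : associative tens_mul.
Proof.
elim/tens_ind=> x; elim/tens_ind=> y; elim/tens_ind=> z.
by rewrite !tens_mulE; apply/tens_class_eq; exact: trel_mulA.
Qed.
Lemma tens_mulC : commutative tens_mul.
Proof.
elim/tens_ind=> x; elim/tens_ind=> y.
by rewrite !tens_mulE; apply/tens_class_eq; exact: trel_mulC.
Qed.
Lemma tens_mul1 : left_id (tens_class (TCst 1)) tens_mul.
Proof.
by elim/tens_ind=> x; rewrite !tens_mulE; apply/tens_class_eq; exact: trel_mul1.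
Qed.
Lemma tens_mulDl : left_distributive tens_mul tens_add.
Proof.
elim/tens_ind=> x; elim/tens_ind=> y; elim/tens_ind=> z.
rewrite !(tens_mulE, tens_addE); apply/tens_class_eq; exact: trel_mulDl.
Qed.

HB.instance Definition _ := GRing.isZmodule.Build tens_ring
  tens_addA tens_addC tens_add0 tens_addN.
HB.instance Definition _ := GRing.Zmodule_isComPzRing.Build tens_ring
  tens_mulA tens_mulC tens_mul1 tens_mulDl.

Definition tens_cst (c : k) : tens_ring := tens_class (TCst c).

Lemma tens_cst_zmod : zmod_morphism tens_cst.
Proof.
move=> c d; apply/eqP; rewrite eq_sym subr_eq; apply/eqP.
by rewrite /tens_cst [RHS]tens_addE -[in LHS](subrK d c); apply/tens_class_eq/trel_cstD.
Qed.
Lemma tens_cst_monoid : monoid_morphism tens_cst.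
Proof.
by split=> // c d; rewrite /tens_cst [RHS]tens_mulE; apply/tens_class_eq/trel_cstM.
Qed.
HB.instance Definition _ := GRing.isZmodMorphism.Build k tens_ring tens_cst
  tens_cst_zmod.
HB.instance Definition _ := GRing.isMonoidMorphism.Build k tens_ring tens_cst
  tens_cst_monoid.

Definition tensor : algebra k := Algebra (tens_cst : {rmorphism k -> tens_ring}).

Definition tens_gen i (a : A i) : tens_ring := tens_class (TGen a).

Lemma tens_gen_zmod i : zmod_morphism (@tens_gen i).
Proof.
move=> a b; apply/eqP; rewrite eq_sym subr_eq; apply/eqP.
by rewrite /tens_gen [RHS]tens_addE -[in LHS](subrK b a); apply/tens_class_eq/trel_genD.
Qed.
Lemma tens_gen_monoid i : monoid_morphism (@tens_gen i).
Proof.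
split; last first.
  by move=> a b; rewrite /tens_gen [RHS]tens_mulE; apply/tens_class_eq/trel_genM.
by rewrite /tens_gen -(rmorph1 (alg_map (A i))); apply/tens_class_eq; exact: trel_genC.
Qed.
HB.instance Definition _ i := GRing.isZmodMorphism.Build (A i) tens_ring
  (@tens_gen i) (@tens_gen_zmod i).
HB.instance Definition _ i := GRing.isMonoidMorphism.Build (A i) tens_ring
  (@tens_gen i) (@tens_gen_monoid i).

Lemma tens_gen_alg i c : tens_gen (alg_map (A i) c) = alg_map tensor c.
Proof. by apply/tens_class_eq; exact: trel_genC. Qed.

Definition tens_in i : alg_hom (A i) tensor :=
  @AlgHom k (A i) tensor (@tens_gen i : {rmorphism A i -> tens_ring})
    (@tens_gen_alg i).

Section Lift.
Variables (C : algebra k) (f : forall i, alg_hom (A i) C).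

Fixpoint teval (x : texpr) : C :=
  match x with
  | TCst c => alg_map C c
  | TGen i a => f i a
  | TAdd x y => teval x + teval y
  | TOpp x => - teval x
  | TMul x y => teval x * teval y
  end.

Lemma teval_trel x y : trel x y -> teval x = teval y.
Proof.
elim=> {x y} //=.
- by move=> y x z _ -> _ ->.
- by move=> x x' y y' _ -> _ ->.
- by move=> x x' _ ->.
- by move=> x x' y y' _ -> _ ->.
- by move=> x y z; rewrite addrA.
- by move=> x y; rewrite addrC.
- by move=> x; rewrite rmorph0 add0r.
- by move=> x; rewrite rmorph0 addNr.
- by move=> x y z; rewrite mulrA.
- by move=> x y; rewrite mulrC.
- by move=> x; rewrite rmorph1 mul1r.
- by move=> x y z; rewrite mulrDl.
- by move=> c d; rewrite rmorphD.
- by move=> c d; rewrite rmorphM.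
- by move=> i a b; rewrite rmorphD.
- by move=> i a b; rewrite rmorphM.
- by move=> i c; rewrite hom_alg.
Qed.

Definition tens_lift_fun (u : tens_ring) : C := teval (repr u).

Lemma tens_lift_pi x : tens_lift_fun (tens_class x) = teval x.
Proof. exact/teval_trel/trel_repr. Qed.

Lemma tens_lift_zmod : zmod_morphism tens_lift_fun.
Proof.
elim/tens_ind=> x; elim/tens_ind=> y.
have -> : tens_class x - tens_class y = tens_class (TAdd x (TOpp y)).
  by rewrite -tens_addE -tens_oppE.
by rewrite !tens_lift_pi.
Qed.
Lemma tens_lift_monoid : monoid_morphism tens_lift_fun.
Proof.
split; first by rewrite [LHS]tens_lift_pi /= rmorph1.
elim/tens_ind=> x; elim/tens_ind=> y.
have -> : tens_class x * tens_class y = tens_class (TMul x y) by exact: tens_mulE.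
by rewrite !tens_lift_pi.
Qed.
HB.instance Definition _ := GRing.isZmodMorphism.Build tens_ring C
  tens_lift_fun tens_lift_zmod.
HB.instance Definition _ := GRing.isMonoidMorphism.Build tens_ring C
  tens_lift_fun tens_lift_monoid.

Lemma tens_lift_alg c : tens_lift_fun (alg_map tensor c) = alg_map C c.
Proof. exact: tens_lift_pi. Qed.

Definition tens_lift : alg_hom tensor C :=
  @AlgHom k tensor C (tens_lift_fun : {rmorphism tens_ring -> C}) tens_lift_alg.

Lemma tens_lift_in i a : tens_lift (tens_in i a) = f i a.
Proof. exact: tens_lift_pi. Qed.

End Lift.

Lemma tens_ring_ind (P : tensor -> Prop) :
  (forall c, P (alg_map tensor c)) -> (forall i a, P (tens_in i a)) ->
  (forall x y, P x -> P y -> P (x + y)) -> (forall x, P x -> P (- x)) ->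
  (forall x y, P x -> P y -> P (x * y)) -> forall z, P z.
Proof.
move=> Pc Pi PD PN PM; elim/tens_ind; elim=> [c|i a|x Px y Py|x Px|x Px y Py].
- exact: Pc.
- exact: Pi.
- by have := PD _ _ Px Py; rewrite [_ + _]tens_addE.
- by have := PN _ Px; rewrite [- _]tens_oppE.
- by have := PM _ _ Px Py; rewrite [_ * _]tens_mulE.
Qed.

Lemma tens_ext (C : algebra k) (g h : alg_hom tensor C) :
  (forall i a, g (tens_in i a) = h (tens_in i a)) -> g =1 h.
Proof.
move=> gh; elim/tens_ring_ind=> [c|i a|x y IHx IHy|x IHx|x y IHx IHy].
- by rewrite !hom_alg.
- exact: gh.
- by rewrite !rmorphD IHx IHy.
- by rewrite !rmorphN IHx.
- by rewrite !rmorphM IHx IHy.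
Qed.

End TensorRing.

Section Tensor2.
Variable (k : comPzRingType).
Implicit Types A B C : algebra k.

Definition pair_family A B (b : bool) : algebra k := if b then A else B.

Definition tens2 A B : algebra k := tensor (pair_family A B).

(* a |-> a (x) 1 and b |-> 1 (x) b *)
Definition tens_inl A B : alg_hom A (tens2 A B) := tens_in (pair_family A B) true.
Definition tens_inr A B : alg_hom B (tens2 A B) := tens_in (pair_family A B) false.

Definition tens_pure A B (a : A) (b : B) : tens2 A B :=
  tens_inl A B a * tens_inr A B b.

Definition lift2 A B C (f : alg_hom A C) (g : alg_hom B C) :
  alg_hom (tens2 A B) C :=
  tens_lift (fun b : bool =>
    if b return alg_hom (pair_family A B b) C then f else g).

Lemma lift2l A B C (f : alg_hom A C) (g : alg_hom B C) a :
  lift2 f g (tens_inl A B a) = f a.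
Proof. exact: tens_lift_in. Qed.

Lemma lift2r A B C (f : alg_hom A C) (g : alg_hom B C) b :
  lift2 f g (tens_inr A B b) = g b.
Proof. exact: tens_lift_in. Qed.

Lemma ext2 A B C (g h : alg_hom (tens2 A B) C) :
  (forall a, g (tens_inl A B a) = h (tens_inl A B a)) ->
  (forall b, g (tens_inr A B b) = h (tens_inr A B b)) -> g =1 h.
Proof. by move=> gl gr; apply: tens_ext; case; [exact: gl|exact: gr]. Qed.

Definition map2 A B A' B' (f : alg_hom A A') (g : alg_hom B B') :
  alg_hom (tens2 A B) (tens2 A' B') :=
  lift2 (comp_hom (tens_inl A' B') f) (comp_hom (tens_inr A' B') g).

Lemma map2l A B A' B' (f : alg_hom A A') (g : alg_hom B B') a :
  map2 f g (tens_inl A B a) = tens_inl A' B' (f a).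
Proof. by rewrite lift2l. Qed.

Lemma map2r A B A' B' (f : alg_hom A A') (g : alg_hom B B') b :
  map2 f g (tens_inr A B b) = tens_inr A' B' (g b).
Proof. by rewrite lift2r. Qed.

Definition tens_assoc A B C :
  alg_hom (tens2 (tens2 A B) C) (tens2 A (tens2 B C)) :=
  lift2 (map2 (id_hom A) (tens_inl B C))
        (comp_hom (tens_inr A (tens2 B C)) (tens_inr B C)).

End Tensor2.

(* [tens2 A B] is the tensor product of modules: it is spanned by the pure    *)
(* tensors, and every balanced biadditive map factors through it.             *)
Section Balanced.
Variables (k : comPzRingType) (A B : algebra k).

Lemma tens2_span (z : tens2 A B) :
  exists s : seq (A * B), z = \sum_(p <- s) tens_pure p.1 p.2.
Proof.
elim/tens_ring_ind: z.
- move=> c; exists [:: (alg_map A c, 1)].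
  by rewrite big_seq1 /= /tens_pure rmorph1 mulr1 hom_alg.
- case=> a; [exists [:: (a, 1)]|exists [:: (1, a)]]; rewrite big_seq1.
    by rewrite /tens_pure rmorph1 mulr1.
  by rewrite /tens_pure rmorph1 mul1r.
- by move=> _ _ [s ->] [s' ->]; exists (s ++ s'); rewrite big_cat.
- move=> _ [s ->]; exists [seq (- p.1, p.2) | p <- s].
  rewrite big_map -sumrN; apply: eq_bigr => p _.
  by rewrite /tens_pure rmorphN mulNr.
- move=> _ _ [s ->] [s' ->].
  exists [seq (p.1 * q.1, p.2 * q.2) | p <- s, q <- s'].
  rewrite big_allpairs_dep big_distrl; apply: eq_bigr => p _ /=.
  rewrite big_distrr; apply: eq_bigr => q _ /=.
  by rewrite /tens_pure !rmorphM mulrACA.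
Qed.

Variable M : zmodType.

Definition balanced (b : A -> B -> M) : Prop :=
  [/\ forall x x' y, b (x + x') y = b x y + b x' y,
      forall x y y', b x (y + y') = b x y + b x y' &
      forall c x y, b (alg_map A c * x) y = b x (alg_map B c * y)].

Fixpoint bal_act (e : texpr (pair_family A B)) (b : A -> B -> M) :
    A -> B -> M :=
  match e with
  | TCst c => fun x y => b (alg_map A c * x) y
  | TGen i a =>
      (if i return pair_family A B i -> A -> B -> M
       then fun a x y => b (a * x) y else fun a x y => b x (a * y)) a
  | TAdd e e' => fun x y => bal_act e b x y + bal_act e' b x y
  | TOpp e => fun x y => - bal_act e b x y
  | TMul e e' => bal_act e (bal_act e' b)
  end.

Lemma bal_act_balanced e b : balanced b -> balanced (bal_act e b).
Proof.
elim: e b => [c|[] a|e IHe e' IHe'|e IHe|e IHe e' IHe'] b bb /=.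
- case: bb => bl br bc; split=> [x x' y|x y y'|d x y].
  + by rewrite mulrDr bl.
  + by rewrite br.
  + by rewrite mulrCA [LHS]bc.
- case: bb => bl br bc; split=> [x x' y|x y y'|d x y].
  + by rewrite mulrDr bl.
  + by rewrite br.
  + by rewrite mulrCA [LHS]bc.
- case: bb => bl br bc; split=> [x x' y|x y y'|d x y].
  + by rewrite bl.
  + by rewrite mulrDr br.
  + by rewrite [LHS]bc mulrCA.
- have [l r c] := IHe _ bb; have [l' r' c'] := IHe' _ bb.
  split=> [x x' y|x y y'|d x y]; last by rewrite c c'.
    by rewrite l l' addrACA.
  by rewrite r r' addrACA.
- have [l r c] := IHe _ bb.
  by split=> [x x' y|x y y'|d x y]; rewrite ?l ?r ?c ?opprD.
- exact/IHe/IHe'.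
Qed.

Lemma bal_actD e b b' :
  bal_act e (fun x y => b x y + b' x y) =
  (fun x y => bal_act e b x y + bal_act e b' x y).
Proof.
elim: e b b' => [c|[] a|e IHe e' IHe'|e IHe|e IHe e' IHe'] b b' //=.
- by rewrite IHe IHe'; apply/funext=> x; apply/funext=> y; rewrite addrACA.
- by rewrite IHe; apply/funext=> x; apply/funext=> y; rewrite opprD.
- by rewrite IHe' IHe.
Qed.

Lemma bal_actN e b :
  bal_act e (fun x y => - b x y) = (fun x y => - bal_act e b x y).
Proof.
elim: e b => [c|[] a|e IHe e' IHe'|e IHe|e IHe e' IHe'] b //=.
- by rewrite IHe IHe'; apply/funext=> x; apply/funext=> y; rewrite opprD.
- by rewrite IHe.
- by rewrite IHe' IHe.
Qed.

Lemma bal_actM e b u v :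
  bal_act e (fun x y => b (u * x) (v * y)) =
  (fun x y => bal_act e b (u * x) (v * y)).
Proof.
elim: e b => [c|[] a|e IHe e' IHe'|e IHe|e IHe e' IHe'] b /=.
- by apply/funext=> x; apply/funext=> y; rewrite mulrCA.
- by apply/funext=> x; apply/funext=> y; rewrite mulrCA.
- by apply/funext=> x; apply/funext=> y; rewrite [v * _]mulrCA.
- by rewrite IHe IHe'.
- by rewrite IHe.
- by rewrite IHe' IHe.
Qed.

Lemma bal_actC e e' b : bal_act e (bal_act e' b) = bal_act e' (bal_act e b).
Proof.
have L u f : (fun x y => f (u * x) y) = (fun x y => f (u * x) (1 * y))
    :> (A -> B -> M).
  by apply/funext=> x; apply/funext=> y; rewrite mul1r.
have R u f : (fun x y => f x (u * y)) = (fun x y => f (1 * x) (u * y))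
    :> (A -> B -> M).
  by apply/funext=> x; apply/funext=> y; rewrite mul1r.
elim: e e' b => [c|[] a|e1 IH1 e2 IH2|e IHe|e1 IH1 e2 IH2] e' b /=.
- by rewrite (L _ b) bal_actM L.
- by rewrite (L _ b) bal_actM L.
- by rewrite (R _ b) bal_actM R.
- by rewrite bal_actD IH1 IH2.
- by rewrite bal_actN IHe.
- by rewrite IH2 IH1.
Qed.

Lemma bal_act_trel e e' b :
  trel e e' -> balanced b -> bal_act e b = bal_act e' b.
Proof.
move=> ee'; elim: ee' b => {e e'} //=.
- by move=> e e' _ IH b bb; rewrite IH.
- by move=> e f g _ IH _ IH' b bb; rewrite IH // IH'.
- by move=> e e' f f' _ IH _ IH' b bb; rewrite IH // IH'.
- by move=> e e' _ IH b bb; rewrite IH.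
- move=> e e' f f' _ IH _ IH' b bb; rewrite IH' // IH //.
  exact: bal_act_balanced.
- by move=> e f g b bb; apply/funext=> x; apply/funext=> y; rewrite addrA.
- by move=> e f b bb; apply/funext=> x; apply/funext=> y; rewrite addrC.
- move=> e b [bl _ _]; apply/funext=> x; apply/funext=> y.
  have b0 z : b 0 z = 0 by apply/(addIr (b 0 z)); rewrite -bl !add0r.
  by rewrite rmorph0 mul0r b0 add0r.
- move=> e b [bl _ _]; apply/funext=> x; apply/funext=> y.
  have b0 z : b 0 z = 0 by apply/(addIr (b 0 z)); rewrite -bl !add0r.
  by rewrite rmorph0 mul0r b0 addNr.
- by move=> e f b bb; exact: bal_actC.
- move=> e b bb; apply/funext=> x; apply/funext=> y.
  have [_ _ _] := bal_act_balanced e bb.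
  by rewrite rmorph1 mul1r.
- move=> c d b [bl _ _]; apply/funext=> x; apply/funext=> y.
  by rewrite rmorphD mulrDl bl.
- move=> c d b [bl _ _]; apply/funext=> x; apply/funext=> y.
  by rewrite rmorphM -mulrA mulrCA.
- move=> [] u v b [bl br _]; apply/funext=> x; apply/funext=> y.
    by rewrite mulrDl bl.
  by rewrite mulrDl br.
- move=> [] u v b [bl br _]; apply/funext=> x; apply/funext=> y.
    by rewrite -mulrA mulrCA.
  by rewrite -mulrA mulrCA.
- move=> [] c b [_ _ bc]; apply/funext=> x; apply/funext=> y //.
Qed.

Lemma tens2_balanced (b : A -> B -> M) : balanced b ->
  exists2 f : tens2 A B -> M, zmod_morphism f &
    forall x y, f (tens_pure x y) = b x y.
Proof.
move=> bb; pose f (z : tens2 A B) := bal_act (repr (z : tens_ring _)) b 1 1.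
have fE e : f (tens_class e) = bal_act e b 1 1.
  by rewrite /f (bal_act_trel (trel_repr e) bb).
exists f => [|x y].
  elim/tens_ind=> e; elim/tens_ind=> e'.
  have -> : (tens_class e : tens2 A B) - tens_class e' =
      tens_class (TAdd e (TOpp e')) by rewrite -tens_addE -tens_oppE.
  by rewrite !fE.
have -> : tens_pure x y =
    tens_class (TMul (@TGen _ _ (pair_family A B) true x)
                     (@TGen _ _ (pair_family A B) false y)).
  by rewrite -tens_mulE.
by rewrite fE /= !mulr1.
Qed.

End Balanced.

(* Commutative Hopf algebras. The antipode is an algebra morphism because it  *)
(* is the comorphism of the inversion of the group scheme.                    *)
Record hopf_algebra (k : comPzRingType) := HopfAlgebra {
  hopf_alg :> algebra k;
  comul : alg_hom hopf_alg (tens2 hopf_alg hopf_alg);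
  counit : alg_hom hopf_alg (base_algebra k);
  antipode : alg_hom hopf_alg hopf_alg;
  hopf_coassoc : forall a,
    tens_assoc _ _ _ (map2 comul (id_hom hopf_alg) (comul a)) =
    map2 (id_hom hopf_alg) comul (comul a);
  hopf_counitl : forall a,
    lift2 (comp_hom (unit_hom hopf_alg) counit) (id_hom hopf_alg) (comul a) = a;
  hopf_counitr : forall a,
    lift2 (id_hom hopf_alg) (comp_hom (unit_hom hopf_alg) counit) (comul a) = a;
  hopf_antipodel : forall a,
    lift2 antipode (id_hom hopf_alg) (comul a) = unit_hom hopf_alg (counit a);
  hopf_antipoder : forall a,
    lift2 (id_hom hopf_alg) antipode (comul a) = unit_hom hopf_alg (counit a) }.

Arguments comul {k} h.
Arguments counit {k} h.
Arguments antipode {k} h.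

Section Base.
Variables (k k' : comPzRingType) (t : {rmorphism k -> k'}).

Definition semi_map2 (A B : algebra k) (A' B' : algebra k')
    (f : alg_hom A (restr_scalars t A')) (g : alg_hom B (restr_scalars t B')) :
    alg_hom (tens2 A B) (restr_scalars t (tens2 A' B')) :=
  lift2 (comp_hom (restr_hom t (tens_inl A' B')) f)
        (comp_hom (restr_hom t (tens_inr A' B')) g).

Lemma semi_map2l A B A' B' f g a :
  @semi_map2 A B A' B' f g (tens_inl A B a) = tens_inl A' B' (f a).
Proof. by rewrite /semi_map2 lift2l. Qed.

Lemma semi_map2r A B A' B' f g b :
  @semi_map2 A B A' B' f g (tens_inr A B b) = tens_inr A' B' (g b).
Proof. by rewrite /semi_map2 lift2r. Qed.

Section Transport.
Variables (A : hopf_algebra k) (A' : algebra k').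
Variables (cm : alg_hom A' (tens2 A' A')) (cu : alg_hom A' (base_algebra k')).
Variables (an : alg_hom A' A') (u : alg_hom A (restr_scalars t A')).
Hypothesis cmE : forall a, cm (u a) = semi_map2 u u (comul A a).
Hypothesis cuE : forall a, cu (u a) = t (counit A a).
Hypothesis anE : forall a, an (u a) = u (antipode A a).

Let u3 : alg_hom (tens2 A (tens2 A A))
    (restr_scalars t (tens2 A' (tens2 A' A'))) :=
  semi_map2 u (semi_map2 u u).

Lemma transport_assoc x :
  tens_assoc A' A' A' (semi_map2 (semi_map2 u u) u x) = u3 (tens_assoc A A A x).
Proof.
pose f := comp_hom (restr_hom t (tens_assoc A' A' A'))
  (semi_map2 (semi_map2 u u) u).
pose g := comp_hom u3 (tens_assoc A A A).
apply: (ext2 (g := f) (h := g)) x => [y|c]; rewrite /=.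
- pose f' := comp_hom f (tens_inl (tens2 A A) A).
  pose g' := comp_hom g (tens_inl (tens2 A A) A).
  apply: (ext2 (g := f') (h := g')) y => [a|b]; rewrite /=.
  + by rewrite !(semi_map2l, semi_map2r, lift2l, lift2r, map2l, map2r).
  + rewrite semi_map2l semi_map2r !lift2l !map2r.
    by rewrite /u3 semi_map2r semi_map2l.
- by rewrite semi_map2r !lift2r /= /u3 !semi_map2r.
Qed.

Lemma transport_coassoc a :
  tens_assoc _ _ _ (map2 cm (id_hom A') (cm (u a))) =
  map2 (id_hom A') cm (cm (u a)).
Proof.
have L x : map2 cm (id_hom A') (semi_map2 u u x) =
    semi_map2 (semi_map2 u u) u (map2 (comul A) (id_hom A) x).
  apply: (ext2 (g := comp_hom (restr_hom t (map2 cm (id_hom A')))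
                              (semi_map2 u u))
    (h := comp_hom (semi_map2 (semi_map2 u u) u)
                   (map2 (comul A) (id_hom A)))) x => [y|y] /=.
    by rewrite semi_map2l !map2l semi_map2l cmE.
  by rewrite semi_map2r !map2r semi_map2r.
have R x : map2 (id_hom A') cm (semi_map2 u u x) =
    u3 (map2 (id_hom A) (comul A) x).
  apply: (ext2 (g := comp_hom (restr_hom t (map2 (id_hom A') cm))
                              (semi_map2 u u))
    (h := comp_hom u3 (map2 (id_hom A) (comul A)))) x => [y|y] /=.
    by rewrite /u3 semi_map2l !map2l semi_map2l.
  by rewrite /u3 semi_map2r !map2r semi_map2r cmE.
by rewrite cmE L R transport_assoc hopf_coassoc.
Qed.

Lemma transport_lift2 (f g : alg_hom A A) (f' g' : alg_hom A' A') x :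
  (forall a, f' (u a) = u (f a)) -> (forall a, g' (u a) = u (g a)) ->
  lift2 f' g' (semi_map2 u u x) = u (lift2 f g x).
Proof.
move=> ff gg.
apply: (ext2 (g := comp_hom (restr_hom t (lift2 f' g')) (semi_map2 u u))
   (h := comp_hom u (lift2 f g))) x => [y|y] /=.
  by rewrite semi_map2l !lift2l.
by rewrite semi_map2r !lift2r.
Qed.

Lemma transport_unit c : unit_hom A' (t c) = u (unit_hom A c).
Proof. by rewrite [RHS](hom_alg u). Qed.

Lemma transport_counitl a :
  lift2 (comp_hom (unit_hom A') cu) (id_hom A') (cm (u a)) = u a.
Proof.
rewrite cmE (transport_lift2 (f := comp_hom (unit_hom A) (counit A))
  (g := id_hom A)) ?hopf_counitl // => b /=.
by rewrite cuE; exact: transport_unit.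
Qed.

Lemma transport_counitr a :
  lift2 (id_hom A') (comp_hom (unit_hom A') cu) (cm (u a)) = u a.
Proof.
rewrite cmE (transport_lift2 (g := comp_hom (unit_hom A) (counit A))
  (f := id_hom A)) ?hopf_counitr // => b /=.
by rewrite cuE; exact: transport_unit.
Qed.

Lemma transport_antipodel a :
  lift2 an (id_hom A') (cm (u a)) = unit_hom A' (cu (u a)).
Proof.
rewrite cmE (transport_lift2 (f := antipode A) (g := id_hom A)) //.
by rewrite hopf_antipodel cuE transport_unit.
Qed.

Lemma transport_antipoder a :
  lift2 (id_hom A') an (cm (u a)) = unit_hom A' (cu (u a)).
Proof.
rewrite cmE (transport_lift2 (f := id_hom A) (g := antipode A)) //.
by rewrite hopf_antipoder cuE transport_unit.
Qed.

End Transport.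

(* The base change A (x)_k k' along t : k -> k', a k'-algebra via the right   *)
(* factor.                                                                    *)
Definition base_change (A : algebra k) : algebra k' :=
  @Algebra k' (tens2 A (restr_scalars t (base_algebra k')))
    (tens_inr A (restr_scalars t (base_algebra k'))).

Section BaseChange.
Variable (A : algebra k).

(* a (x) c *)
Definition bc_pure (a : A) (c : k') : base_change A :=
  @tens_pure k A (restr_scalars t (base_algebra k')) a c.

Lemma bc_in_alg c :
  tens_inl A (restr_scalars t (base_algebra k')) (alg_map A c) =
  alg_map (restr_scalars t (base_change A)) c.
Proof.
by rewrite hom_alg -(hom_alg (tens_inr A (restr_scalars t (base_algebra k')))).
Qed.

(* a |-> a (x) 1 *)
Definition bc_in : alg_hom A (restr_scalars t (base_change A)) :=
  @AlgHom k A (restr_scalars t (base_change A))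
    (tens_inl A (restr_scalars t (base_algebra k'))) bc_in_alg.

Section BcLift.
Variables (C : algebra k') (f : alg_hom A (restr_scalars t C)).

Let bc_lift0 :
    alg_hom (tens2 A (restr_scalars t (base_algebra k'))) (restr_scalars t C) :=
  lift2 f (restr_hom t (unit_hom C)).

Lemma bc_lift_alg c : bc_lift0 (alg_map (base_change A) c) = alg_map C c.
Proof. exact: (lift2r f (restr_hom t (unit_hom C)) c). Qed.

Definition bc_lift : alg_hom (base_change A) C :=
  @AlgHom k' (base_change A) C bc_lift0 bc_lift_alg.

Lemma bc_lift_in a : bc_lift (bc_in a) = f a.
Proof. exact: (lift2l f (restr_hom t (unit_hom C)) a). Qed.

Lemma bc_lift_pure a c : bc_lift (bc_pure a c) = f a * alg_map C c.
Proof.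
rewrite [LHS]rmorphM; congr (_ * _); first exact: bc_lift_in.
exact: bc_lift_alg.
Qed.

End BcLift.

Lemma bc_ext (C : algebra k') (g h : alg_hom (base_change A) C) :
  (forall a, g (bc_in a) = h (bc_in a)) -> g =1 h.
Proof.
move=> gh.
have H (f : alg_hom (base_change A) C) c :
    f (tens_inl A (restr_scalars t (base_algebra k')) (alg_map A c)) =
    alg_map C (t c).
  by rewrite bc_in_alg [LHS](hom_alg f).
have L (f : alg_hom (base_change A) C) c :
    f (alg_map (tens2 A (restr_scalars t (base_algebra k'))) c) =
    alg_map (restr_scalars t C) c.
  by rewrite [RHS](esym (H f c)) (hom_alg (tens_inl _ _)).
pose mk (f : alg_hom (base_change A) C) := @AlgHom k (tens2 A (restr_scalars t (base_algebra k')))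
  (restr_scalars t C) (hom_fun f) (L f).
apply: (ext2 (g := mk g) (h := mk h)) => [a|c]; first exact: gh.
by rewrite [LHS](hom_alg g) [RHS](hom_alg h).
Qed.

End BaseChange.

Section HopfBaseChange.
Variable (A : hopf_algebra k).
Let A' := base_change A.

Definition bc_comul : alg_hom A' (tens2 A' A') :=
  bc_lift (comp_hom (semi_map2 (bc_in A) (bc_in A)) (comul A)).
Definition bc_counit : alg_hom A' (base_algebra k') :=
  bc_lift (comp_hom (unit_hom (restr_scalars t (base_algebra k'))) (counit A)).
Definition bc_antipode : alg_hom A' A' :=
  bc_lift (comp_hom (bc_in A) (antipode A)).

Lemma bc_comulE a :
  bc_comul (bc_in A a) = semi_map2 (bc_in A) (bc_in A) (comul A a).
Proof. exact: bc_lift_in. Qed.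
Lemma bc_counitE a : bc_counit (bc_in A a) = t (counit A a).
Proof. exact: bc_lift_in. Qed.
Lemma bc_antipodeE a : bc_antipode (bc_in A a) = bc_in A (antipode A a).
Proof. exact: bc_lift_in. Qed.

Lemma bc_coassoc a :
  tens_assoc _ _ _ (map2 bc_comul (id_hom A') (bc_comul a)) =
  map2 (id_hom A') bc_comul (bc_comul a).
Proof.
apply: (bc_ext (g := comp_hom (tens_assoc _ _ _)
    (comp_hom (map2 bc_comul (id_hom A')) bc_comul))
  (h := comp_hom (map2 (id_hom A') bc_comul) bc_comul)) a => a.
exact: (transport_coassoc bc_comulE).
Qed.
Lemma bc_counitl a :
  lift2 (comp_hom (unit_hom A') bc_counit) (id_hom A') (bc_comul a) = a.
Proof.
apply: (bc_ext (g := comp_hom (lift2 (comp_hom (unit_hom A') bc_counit)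
  (id_hom A')) bc_comul) (h := id_hom A')) a => a.
exact: (transport_counitl bc_comulE bc_counitE).
Qed.
Lemma bc_counitr a :
  lift2 (id_hom A') (comp_hom (unit_hom A') bc_counit) (bc_comul a) = a.
Proof.
apply: (bc_ext (g := comp_hom (lift2 (id_hom A')
  (comp_hom (unit_hom A') bc_counit)) bc_comul) (h := id_hom A')) a => a.
exact: (transport_counitr bc_comulE bc_counitE).
Qed.
Lemma bc_antipodel a :
  lift2 bc_antipode (id_hom A') (bc_comul a) = unit_hom A' (bc_counit a).
Proof.
apply: (bc_ext (g := comp_hom (lift2 bc_antipode (id_hom A')) bc_comul)
  (h := comp_hom (unit_hom A') bc_counit)) a => a.
exact: (transport_antipodel bc_comulE bc_counitE bc_antipodeE).
Qed.
Lemma bc_antipoder a :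
  lift2 (id_hom A') bc_antipode (bc_comul a) = unit_hom A' (bc_counit a).
Proof.
apply: (bc_ext (g := comp_hom (lift2 (id_hom A') bc_antipode) bc_comul)
  (h := comp_hom (unit_hom A') bc_counit)) a => a.
exact: (transport_antipoder bc_comulE bc_counitE bc_antipodeE).
Qed.

Definition hopf_base_change : hopf_algebra k' :=
  HopfAlgebra bc_coassoc bc_counitl bc_counitr bc_antipodel bc_antipoder.

End HopfBaseChange.
End Base.

(* The coordinate ring of the product of a family of affine group schemes.    *)
Section HopfTensor.
Variables (k : comPzRingType) (I : Type) (A : I -> hopf_algebra k).
Let T : algebra k := tensor A.
Let inA i : alg_hom (A i) T := tens_in A i.

Definition ht_comul : alg_hom T (tens2 T T) :=
  tens_lift (fun i => comp_hom (map2 (inA i) (inA i)) (comul (A i))).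
Definition ht_counit : alg_hom T (base_algebra k) :=
  tens_lift (fun i => counit (A i)).
Definition ht_antipode : alg_hom T T :=
  tens_lift (fun i => comp_hom (inA i) (antipode (A i))).

(* [inA i], with target seen as the restriction of scalars along the identity *)
Let u i : alg_hom (A i) (restr_scalars (idfun : {rmorphism k -> k}) T) :=
  @AlgHom k (A i) (restr_scalars (idfun : {rmorphism k -> k}) T) (inA i)
    (hom_alg (inA i)).

Lemma ht_comulE i a : ht_comul (u i a) = semi_map2 (u i) (u i) (comul (A i) a).
Proof.
rewrite [LHS]tens_lift_in /=.
pose g := semi_map2 (u i) (u i).
have gE c : g (alg_map _ c) = alg_map (tens2 T T) c by rewrite hom_alg.
apply: (ext2 (g := map2 (inA i) (inA i))
  (h := @AlgHom k (tens2 (A i) (A i)) (tens2 T T) (hom_fun g) gE)) => b.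
  by rewrite map2l [RHS]semi_map2l.
by rewrite map2r [RHS]semi_map2r.
Qed.
Lemma ht_counitE i a : ht_counit (u i a) = counit (A i) a.
Proof. exact: tens_lift_in. Qed.
Lemma ht_antipodeE i a : ht_antipode (u i a) = u i (antipode (A i) a).
Proof. exact: tens_lift_in. Qed.

Lemma ht_coassoc a :
  tens_assoc _ _ _ (map2 ht_comul (id_hom T) (ht_comul a)) =
  map2 (id_hom T) ht_comul (ht_comul a).
Proof.
apply: (tens_ext (g := comp_hom (tens_assoc _ _ _)
    (comp_hom (map2 ht_comul (id_hom T)) ht_comul))
  (h := comp_hom (map2 (id_hom T) ht_comul) ht_comul)) a => i a.
exact: (transport_coassoc (@ht_comulE i)).
Qed.
Lemma ht_counitl a :
  lift2 (comp_hom (unit_hom T) ht_counit) (id_hom T) (ht_comul a) = a.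
Proof.
apply: (tens_ext (g := comp_hom (lift2 (comp_hom (unit_hom T) ht_counit)
  (id_hom T)) ht_comul) (h := id_hom T)) a => i a.
exact: (transport_counitl (@ht_comulE i) (@ht_counitE i)).
Qed.
Lemma ht_counitr a :
  lift2 (id_hom T) (comp_hom (unit_hom T) ht_counit) (ht_comul a) = a.
Proof.
apply: (tens_ext (g := comp_hom (lift2 (id_hom T)
  (comp_hom (unit_hom T) ht_counit)) ht_comul) (h := id_hom T)) a => i a.
exact: (transport_counitr (@ht_comulE i) (@ht_counitE i)).
Qed.
Lemma ht_antipodel a :
  lift2 ht_antipode (id_hom T) (ht_comul a) = unit_hom T (ht_counit a).
Proof.
apply: (tens_ext (g := comp_hom (lift2 ht_antipode (id_hom T)) ht_comul)
  (h := comp_hom (unit_hom T) ht_counit)) a => i a.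
exact: (transport_antipodel (@ht_comulE i) (@ht_counitE i) (@ht_antipodeE i)).
Qed.
Lemma ht_antipoder a :
  lift2 (id_hom T) ht_antipode (ht_comul a) = unit_hom T (ht_counit a).
Proof.
apply: (tens_ext (g := comp_hom (lift2 (id_hom T) ht_antipode) ht_comul)
  (h := comp_hom (unit_hom T) ht_counit)) a => i a.
exact: (transport_antipoder (@ht_comulE i) (@ht_counitE i) (@ht_antipodeE i)).
Qed.

Definition hopf_tensor : hopf_algebra k :=
  HopfAlgebra ht_coassoc ht_counitl ht_counitr ht_antipodel ht_antipoder.

End HopfTensor.

Record sigma_field (n : nat) := SigmaField {
  sf_field :> fieldType;
  sigma : 'I_n -> {rmorphism sf_field -> sf_field};
  sigma_comm : forall i j x, sigma i (sigma j x) = sigma j (sigma i x) }.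

Arguments sigma {n} s.

(* The monoid T_sigma is the type 'X_{1..n} of exponent vectors, written      *)
(* additively; ord is mdeg, and the finite type 'X_{1..n < i.+1} is           *)
(* T_sigma[i].                                                                *)
Section Action.
Variables (n : nat) (k : sigma_field n).

Definition sigma_act (m : 'X_{1..n}) (x : k) : k :=
  foldr (fun j y => iter (m j) (sigma k j) y) x (enum 'I_n).

Lemma sigma_act_zmod m : zmod_morphism (sigma_act m).
Proof.
rewrite /sigma_act => x y; elim: (enum _) => //= j s ->.
by elim: (m j) => //= p ->; rewrite rmorphB.
Qed.
Lemma sigma_act_monoid m : monoid_morphism (sigma_act m).
Proof.
rewrite /sigma_act; split=> [|x y].
  by elim: (enum _) => //= j s ->; elim: (m j) => //= p ->; rewrite rmorph1.
elim: (enum _) => //= j s ->.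
by elim: (m j) => //= p ->; rewrite rmorphM.
Qed.
HB.instance Definition _ m := GRing.isZmodMorphism.Build k k (sigma_act m)
  (sigma_act_zmod m).
HB.instance Definition _ m := GRing.isMonoidMorphism.Build k k (sigma_act m)
  (sigma_act_monoid m).

Lemma sigma_actD (m m' : 'X_{1..n}) x :
  sigma_act (m + m')%MM x = sigma_act m (sigma_act m' x).
Proof.
have itC p q i j y : iter p (sigma k i) (iter q (sigma k j) y) =
    iter q (sigma k j) (iter p (sigma k i) y).
  have itC1 r l y' : sigma k l (iter r (sigma k j) y') =
      iter r (sigma k j) (sigma k l y').
    by elim: r => //= r IHr; rewrite sigma_comm IHr.
  by elim: p => //= p ->; rewrite itC1.
have itF p i s y :
    iter p (sigma k i) (foldr (fun j => iter (m j) (sigma k j)) y s) =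
    foldr (fun j => iter (m j) (sigma k j)) (iter p (sigma k i) y) s.
  by elim: s => //= j s IHs; rewrite itC IHs.
rewrite /sigma_act; elim: (enum _) => //= j s ->.
by rewrite mnmDE iterD itF.
Qed.

Lemma sigma_act0 x : sigma_act 0%MM x = x.
Proof. by rewrite /sigma_act; elim: (enum _) => //= j s ->; rewrite mnm0E. Qed.

Lemma sigma_act1 j x : sigma_act U_(j)%MM x = sigma k j x.
Proof.
rewrite /sigma_act; have := enum_uniq 'I_n; have := mem_enum 'I_n j.
elim: (enum _) => //= i s IHs; rewrite inE mnm1E => /orP[/eqP<-|js].
  case/andP=> js _; rewrite eqxx /=; congr (sigma k j _).
  elim: s js {IHs} => //= l s IHs; rewrite inE negb_or => /andP[jl js].
  by rewrite mnm1E (negbTE jl) IHs.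
case/andP=> nis us; rewrite IHs //; case: eqP => //= ji.
by rewrite -ji js in nis.
Qed.

End Action.

Definition finitely_generated (k : fieldType) (A : algebra k) : Prop :=
  exists (m : nat) (x : 'I_m -> A),
    forall a : A, exists p : {mpoly k[m]},
      a = \sum_(e <- msupp p) alg_map A p@_e * \prod_(i < m) x i ^+ e i.

Record algebraic_group (k : fieldType) := AlgebraicGroup {
  coord :> hopf_algebra k;
  coord_fg : finitely_generated coord }.

Local Open Scope classical_set_scope.

Definition is_ideal (R : comPzRingType) (I : set R) : Prop :=
  [/\ I 0, forall x y, I x -> I y -> I (x + y) & forall a x, I x -> I (a * x)].

Definition ideal_gen (R : comPzRingType) (S : set R) : set R :=
  smallest (@is_ideal R) S.

(* The subspace I (x) H + H (x) I of H (x) H *)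
Definition tens_ideal (k : comPzRingType) (H : algebra k) (I : set H) :
    set (tens2 H H) :=
  [set z | exists2 s : seq (H * H), (forall p, p \in s -> I p.1 \/ I p.2) &
     z = \sum_(p <- s) tens_pure p.1 p.2].

Definition hopf_ideal (k : comPzRingType) (H : hopf_algebra k) (I : set H) :
    Prop :=
  [/\ is_ideal I,
      forall x, I x -> tens_ideal I (comul H x),
      forall x, I x -> counit H x = 0
    & forall x, I x -> I (antipode H x)].

Section GeneralisedGroup.
Variables (n : nat) (k : sigma_field n) (G : algebraic_group k).

(* k[G[i]] *)
Definition coord_upto (i : nat) : hopf_algebra k :=
  hopf_tensor (fun t : 'X_{1..n < i.+1} => hopf_base_change (sigma_act t) G).

Definition coord_factor (i : nat) (t : 'X_{1..n < i.+1}) :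
    alg_hom (base_change (sigma_act t) G) (coord_upto i) :=
  tens_in (fun t : 'X_{1..n < i.+1} => hopf_base_change (sigma_act t) G) t.

Lemma widen_subproof (i : nat) (t : 'X_{1..n < i.+1}) : (mdeg t < i.+2)%N.
Proof. exact: ltnW (bmdeg t). Qed.

Definition widen_mon (i : nat) (t : 'X_{1..n < i.+1}) : 'X_{1..n < i.+2} :=
  BMultinom (widen_subproof t).

Lemma shift_subproof (i : nat) (j : 'I_n) (t : 'X_{1..n < i.+1}) :
  (mdeg (U_(j) + t)%MM < i.+2)%N.
Proof. by rewrite mdegD mdeg1 add1n ltnS bmdeg. Qed.

Definition shift_mon (i : nat) (j : 'I_n) (t : 'X_{1..n < i.+1}) :
  'X_{1..n < i.+2} := BMultinom (shift_subproof j t).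

(* k[G[i]] -> k[G[i+1]] *)
Definition coord_incl (i : nat) : alg_hom (coord_upto i) (coord_upto i.+1) :=
  tens_lift (fun t : 'X_{1..n < i.+1} => coord_factor (widen_mon t)).

Section Sigma.
Variables (i : nat) (j : 'I_n).

Lemma sigma_factor_alg (t : 'X_{1..n < i.+1}) c :
  coord_factor (shift_mon j t)
    (bc_in (sigma_act (shift_mon j t)) G (alg_map G c)) =
  alg_map (restr_scalars (sigma_act t)
            (restr_scalars (sigma k j) (coord_upto i.+1))) c.
Proof.
rewrite (hom_alg (bc_in _ G)) [LHS](hom_alg (coord_factor (shift_mon j t))).
by rewrite /= sigma_actD sigma_act1.
Qed.

(* r (x) c in the factor t |-> r (x) sigma_j(c) in the factor sigma_j t *)
Definition sigma_factor (t : 'X_{1..n < i.+1}) :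
    alg_hom (base_change (sigma_act t) G)
            (restr_scalars (sigma k j) (coord_upto i.+1)) :=
  bc_lift (@AlgHom k G
    (restr_scalars (sigma_act t) (restr_scalars (sigma k j) (coord_upto i.+1)))
    (coord_factor (shift_mon j t) \o bc_in (sigma_act (shift_mon j t)) G :
      {rmorphism G -> coord_upto i.+1})
    (sigma_factor_alg t)).

(* As sigma_j is only semilinear, it is an algebra morphism to k[G[i+1]] with *)
(* scalars restricted along sigma_j : k -> k.                                 *)
Definition coord_sigma :
    alg_hom (coord_upto i) (restr_scalars (sigma k j) (coord_upto i.+1)) :=
  tens_lift sigma_factor.

Lemma coord_sigmaE (t : 'X_{1..n < i.+1}) (r : G) (c : k) :
  coord_sigma (coord_factor t (bc_pure (sigma_act t) r c)) =
  coord_factor (shift_mon j t)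
    (bc_pure (sigma_act (shift_mon j t)) r (sigma k j c)).
Proof.
rewrite [LHS]tens_lift_in [LHS]bc_lift_pure [RHS]rmorphM; congr (_ * _).
exact/esym/(hom_alg (coord_factor (shift_mon j t))).
Qed.

End Sigma.

Definition generalised_sigma_group (I : forall i, set (coord_upto i)) : Prop :=
  (forall i, hopf_ideal (I i)) /\
  (forall i, coord_incl i @` I i `<=` I i.+1 /\
     forall j, coord_sigma i j @` I i `<=` I i.+1).

End GeneralisedGroup.

(* Main.v *)
From HB Require Import structures.
Require Import Defs.
From mathcomp Require Import all_boot all_order all_algebra.
From mathcomp Require Import boolp classical_sets.
From mathcomp Require Import zify mpoly.

Set Implicit Arguments.
Unset Strict Implicit.
Unset Printing Implicit Defensive.

Import GRing.Theory.
Local Open Scope ring_scope.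
Local Open Scope classical_set_scope.

(** Fix i, and let I' be the ideal of k[G[i+1]] generated by I_i and the
sigma_j(I_i). It is a Hopf ideal contained in I_{i+1}, so the two ideals define
closed subgroups G_{i+1} <= G' of the product of the twists of G by the
monomials tau of order at most i+1. The proof compares them one factor at a
time.

Order the monomials by a monomial order. Given a subgroup of the product, take
the points whose coordinates below tau are trivial, and project them to the
factor tau. On the level of ideals this is [fiber_ideal J (below tau)], pulled
back to the coordinate ring of that factor. Nested subgroups for which all these
fibres agree are equal: this is [fiberwise_inclusion], an induction over tau
starting from the top, each step of which is [kernel_image], the fact that
nested subgroups with the same kernel and the same image under a homomorphism
coincide.

The fibres agree for large i by a Noetherian argument. Pull the fibre ideals of
I_i back to a polynomial ring along generators of k[G]. The resulting ideals
A i tau grow with i, and the coefficientwise action of sigma_j maps A i tau into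
A (i+1) (sigma_j tau), because the order is compatible with multiplication.
The coefficient field is moved by sigma_j, so there is no single ascending
chain of ideals; but leading exponents do not see the coefficients. Dickson's
lemma, applied to the triples (i - ord tau, tau, leading exponent), shows that
for large i every leading exponent of A (i+1) tau comes from stage i, and then
division shows that A (i+1) tau is generated by what comes from stage i. This is
[noetherian_family].

For [kernel_image], let I0 be contained in I1, write C = P/I0 and C' = P/I1, let
D be the common image of the coordinate ring B of the target, and let R be the
tensor product of C' and C over D. The tautological points g of G1 and g' of G0
over R have the same image, so g^-1 g' lies in the common kernel, hence in G1,
and so g' lies in G1: every element of I1 vanishes in R. It remains to see that
C embeds in R. This holds because D is locally a direct summand of C' as a
D-module ([hopf_subalgebra_retraction]): every finite subset of C' lies in a
D-submodule that retracts onto D.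

The retraction exists because an ideal of D that is stable under the
comultiplication is 0 or D. Let a_1, ..., a_N be a basis of a finite-dimensional
subcomodule of C', and let K be the module of vectors d in D^N with
sum d_i a_i in D. The ideal of D generated by the t by t minors of vectors of K
is stable, so for the largest t for which it is nonzero it contains 1, and
Cramer's rule assembles a D-linear projection of D^N onto K. *)

(** * Linear maps over a field: extension and dual bases *)
Section LinearExtension.
Variables (k : fieldType) (E F : algebra k).

Definition lin (f : E -> F) : Prop :=
  (forall x y, f (x + y) = f x + f y) /\
  (forall c x, f (alg_map E c * x) = alg_map F c * f x).

(** A partial linear map, encoded by its graph; the last condition makes the
relation single-valued. *)
Definition linear_graph (g : set (E * F)) : Prop :=
  [/\ g (0, 0),
      forall x y x' y', g (x, y) -> g (x', y') -> g (x + x', y + y'),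
      forall c x y, g (x, y) -> g (alg_map E c * x, alg_map F c * y)
    & forall y, g (0, y) -> y = 0].

Lemma linear_graph_maximal g0 : linear_graph g0 ->
  exists g, [/\ linear_graph g, g0 `<=` g
    & forall h, linear_graph h -> g `<=` h -> h `<=` g].
Proof.
move=> lg0.
(* The empty set is let in because the union of the empty chain is empty. *)
pose P (X : set (E * F)) := X = set0 \/ (linear_graph X /\ g0 `<=` X).
have [C CP Ct|g [Pg gmax]] := @Zorn_bigcup _ P.
  have [[X0 CX0 nX0]|allE] := pselect (exists2 X, C X & X <> set0); last first.
    left; apply/seteqP; split=> // p [X CX Xp]; exfalso; apply: allE.
    by exists X => // XE; rewrite XE in Xp.
  right; have good X : C X -> X <> set0 -> linear_graph X /\ g0 `<=` X.
    by move=> /CP[->|].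
  have ne (X : set (E * F)) (p : E * F) : X p -> X <> set0.
    by move=> Xp XE; rewrite XE in Xp.
  have [[X00 _ _ _] gX0] := good _ CX0 nX0.
  split; last by move=> q /gX0 qX; exists X0.
  split; first by exists X0.
  - move=> x y x' y' [X CX Xp] [Y CY Yp].
    have [XY|YX] := Ct _ _ CX CY.
      exists Y => //; have [[_ a _ _] _] := good _ CY (ne _ _ Yp).
      by apply: a => //; exact: XY.
    exists X => //; have [[_ a _ _] _] := good _ CX (ne _ _ Xp).
    by apply: a => //; exact: YX.
  - move=> c x y [X CX Xp]; exists X => //.
    by have [[_ _ a _] _] := good _ CX (ne _ _ Xp); exact: a.
  - move=> y [X CX Xp].
    by have [[_ _ _ a] _] := good _ CX (ne _ _ Xp); exact: a.
have g0g : linear_graph g /\ g0 `<=` g.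
  case: Pg => [g0E|//]; exfalso; apply: (gmax g0); last by right; split.
  rewrite g0E properEneq; split; last by move=> ? [].
  apply/eqP.
  by case: lg0 => g00 _ _ _ XE; rewrite -XE in g00.
case: g0g => lg g0g; exists g; split=> // h lh gh.
apply: contrapT => nhg; apply: (gmax h); first by split.
by right; split=> // p /g0g /gh.
Qed.

(** A maximal partial linear map is total: if e is outside the domain, sending
the line through e to 0 extends it. *)
Lemma linear_extension g0 : linear_graph g0 ->
  exists2 f, lin f & forall x y, g0 (x, y) -> f x = y.
Proof.
move=> /linear_graph_maximal[g [[g00 gD gZ gF] g0g gmax]].
have gU x y y' : g (x, y) -> g (x, y') -> y = y'.
  move=> gy /(gZ (-1)) /(gD _ _ _ _ gy).
  by rewrite !rmorphN1 !mulN1r subrr => /gF /subr0_eq.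
have tot e : exists y, g (e, y).
  apply: contrapT => ne.
  pose h := [set p : E * F | exists c x,
    g (x, p.2) /\ p.1 = x + alg_map E c * e].
  apply: (ne); exists 0; apply: (gmax h); first last.
  - by exists 1, 0; split=> //=; rewrite rmorph1 mul1r add0r.
  - by move=> [x y] gxy; exists 0, x; split=> //=; rewrite rmorph0 mul0r addr0.
  split.
  - by exists 0, 0; split=> //=; rewrite rmorph0 mul0r addr0.
  - move=> x y x' y' [c [z [/= gz ->]]] [c' [z' [/= gz' ->]]].
    exists (c + c'), (z + z'); split=> /=; first exact: gD.
    by rewrite rmorphD mulrDl addrACA.
  - move=> c x y [d [z [/= gz ->]]]; exists (c * d), (alg_map E c * z).
    by split=> /=; [exact: gZ|rewrite rmorphM mulrDr mulrA].
  - move=> y [c [x [/= gx x0]]].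
    have [c0|c0] := eqVneq c 0.
      by move: x0; rewrite c0 rmorph0 mul0r addr0 => x0; apply: gF; rewrite x0.
    exfalso; apply: (ne); exists (alg_map F (- c^-1) * y).
    have -> : e = alg_map E (- c^-1) * x.
      have -> : x = - (alg_map E c * e) by apply/eqP; rewrite -addr_eq0 -x0.
      by rewrite rmorphN mulrNN mulrA -rmorphM mulVf // rmorph1 mul1r.
    exact: gZ.
have [f fP] := choice tot.
exists f => [|x y /g0g gxy]; last exact: gU gxy.
by split=> [x y|c x]; apply: gU (fP _) _; [exact: gD|exact: gZ].
Qed.

Variable (f : E -> F).
Hypothesis fl : lin f.

Lemma lin0 : f 0 = 0.
Proof. by have /eqP := fl.1 0 0; rewrite addr0 -subr_eq subrr eq_sym => /eqP. Qed.

Lemma lin_sum (T : Type) (s : seq T) (P : pred T) (u : T -> E) :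
  f (\sum_(i <- s | P i) u i) = \sum_(i <- s | P i) f (u i).
Proof. by elim/big_rec2: _ => [|i y z _ <-]; rewrite ?lin0 ?fl.1. Qed.

End LinearExtension.

Section DualBasis.
Variables (k : fieldType) (E : algebra k).

Definition functional (t : E -> k) : Prop := @lin k E (base_algebra k) t.

Lemma functional_neq0 (w : E) : w != 0 -> exists2 t, functional t & t w = 1.
Proof.
move=> w0; pose g := [set p : E * base_algebra k | p.1 = alg_map E p.2 * w].
have [|f fl fP] := @linear_extension k E (base_algebra k) g.
  split; rewrite /g /=.
  - by rewrite rmorph0 mul0r.
  - by move=> x y x' y' -> ->; rewrite rmorphD mulrDl.
  - by move=> c x y ->; rewrite rmorphM mulrA.
  - move=> y /esym y0; apply/eqP; apply: contraT => yn0.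
    have := congr1 (fun z => alg_map E y^-1 * z) y0.
    rewrite mulr0 mulrA -rmorphM mulVf // rmorph1 mul1r => w0'.
    by rewrite w0' eqxx in w0.
by exists f => //; apply: fP; rewrite /g /= rmorph1 mul1r.
Qed.

(** Induction on s. A new vector v either reduces to 0 modulo the family found so
far, or its remainder is detected by a functional; composing that functional
with the reduction gives the new functional, and the old ones are corrected to
vanish at v. *)
Lemma dual_basis (s : seq E) : exists N (y : 'I_N -> E) (t : 'I_N -> E -> k),
  [/\ forall l, functional (t l), forall l m, t l (y m) = (l == m)%:R,
      forall v, v \in s -> v = \sum_l alg_map E (t l v) * y l
    & forall l, y l \in s].
Proof.
elim: s => [|v s [N [y [t [tf ty sy ys]]]]].
  by exists 0%N, (fun=> 0), (fun _ _ => 0); split=> //; case.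
pose pr x := x - \sum_l alg_map E (t l x) * y l.
have prD x x' : pr (x + x') = pr x + pr x'.
  rewrite /pr addrACA -opprD; congr (_ - _).
  rewrite -big_split; apply: eq_bigr => l _.
  by rewrite (tf l).1 rmorphD mulrDl.
have prZ c x : pr (alg_map E c * x) = alg_map E c * pr x.
  rewrite /pr mulrBr; congr (_ - _); rewrite mulr_sumr.
  by apply: eq_bigr => l _; rewrite (tf l).2 rmorphM mulrA.
have pry m : pr (y m) = 0.
  rewrite /pr (bigD1 m) //= ty eqxx rmorph1 mul1r big1 ?addr0 ?subrr // => l lm.
  by rewrite ty (negbTE lm) rmorph0 mul0r.
have [v0|v0] := eqVneq (pr v) 0.
  exists N, y, t; split=> // [u|l]; rewrite inE; last by rewrite ys orbT.
  by case/predU1P=> [->|/sy//]; apply/subr0_eq.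
have [e ef ev] := functional_neq0 v0.
pose y' (i : 'I_N.+1) := oapp y v (unlift ord0 i).
pose t' (i : 'I_N.+1) x :=
  oapp (fun l => t l x - t l v * e (pr x)) (e (pr x)) (unlift ord0 i).
exists N.+1, y', t'; split.
- move=> i; rewrite /t'; case: unliftP => [l _|_] /=; split=> [x x'|c x] /=.
  + by rewrite (tf l).1 prD ef.1 mulrDr opprD addrACA.
  + by rewrite (tf l).2 prZ ef.2 /= mulrBr mulrCA.
  + by rewrite prD ef.1.
  + by rewrite prZ ef.2.
- have e0 : e 0 = 0 := lin0 ef.
  move=> i j; rewrite /t' /y'.
  case: (unliftP ord0 j) => [m ->|->] /=; case: (unliftP ord0 i) => [l ->|->] /=.
  + by rewrite pry e0 mulr0 subr0 ty (inj_eq lift_inj).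
  + by rewrite pry e0.
  + by rewrite ev mulr1 subrr.
  + by rewrite ev.
- have main x : pr x = alg_map E (e (pr x)) * pr v ->
      x = \sum_l alg_map E (t' l x) * y' l.
    move=> prx; rewrite big_ord_recl /t' /y' unlift_none /=.
    have -> : \sum_(l < N) alg_map E (oapp (fun l => t l x - t l v * e (pr x))
          (e (pr x)) (unlift ord0 (lift ord0 l))) *
          oapp y v (unlift ord0 (lift ord0 l)) =
        \sum_l alg_map E (t l x) * y l -
        alg_map E (e (pr x)) * \sum_l alg_map E (t l v) * y l.
      rewrite mulr_sumr -sumrB; apply: eq_bigr => l _.
      by rewrite liftK /= rmorphB rmorphM mulrBl mulrCA mulrA.
    rewrite addrCA -mulrBr -/(pr v) -prx.
    by rewrite addrC /pr subrK.
  move=> u; rewrite inE => /predU1P[->|us]; apply: main.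
    by rewrite ev rmorph1 mul1r.
  by rewrite /pr -(sy _ us) subrr (lin0 ef) rmorph0 mul0r.
- move=> i; rewrite /y'; case: unliftP => [l _|_] /=; rewrite inE ?eqxx //.
  by rewrite ys orbT.
Qed.

End DualBasis.

(** * Tensor products over a field in coordinates *)
Section TensorSpan.
Variables (k : comPzRingType) (A B : algebra k).
Implicit Types (X : set A) (Y : set B) (z : tens2 A B).

Definition tens_span X Y : set (tens2 A B) :=
  [set z | exists2 s : seq (A * B), (forall p, p \in s -> X p.1 /\ Y p.2) &
     z = \sum_(p <- s) tens_pure p.1 p.2].

Lemma tens_pureM (a a' : A) (b b' : B) :
  tens_pure a b * tens_pure a' b' = tens_pure (a * a') (b * b').
Proof. by rewrite /tens_pure !rmorphM mulrACA. Qed.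

Lemma tens_pureDl (a a' : A) (b : B) :
  tens_pure (a + a') b = tens_pure a b + tens_pure a' b.
Proof. by rewrite /tens_pure rmorphD mulrDl. Qed.

Lemma tens_pureDr (a : A) (b b' : B) :
  tens_pure a (b + b') = tens_pure a b + tens_pure a b'.
Proof. by rewrite /tens_pure rmorphD mulrDr. Qed.

Lemma tens_pure_suml (T : Type) (s : seq T) (a : T -> A) (b : B) :
  tens_pure (\sum_(i <- s) a i) b = \sum_(i <- s) tens_pure (a i) b.
Proof. by rewrite /tens_pure rmorph_sum mulr_suml. Qed.

Lemma tens_pure_sumr (T : Type) (s : seq T) (a : A) (b : T -> B) :
  tens_pure a (\sum_(i <- s) b i) = \sum_(i <- s) tens_pure a (b i).
Proof. by rewrite /tens_pure rmorph_sum mulr_sumr. Qed.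

Lemma tens_pure_scale c (a : A) (b : B) :
  tens_pure a (alg_map B c * b) = tens_pure (alg_map A c * a) b.
Proof. by rewrite /tens_pure !rmorphM !hom_alg mulrCA mulrA. Qed.

Lemma tens_span_pure X Y a b : X a -> Y b -> tens_span X Y (tens_pure a b).
Proof.
move=> Xa Yb; exists [:: (a, b)]; last by rewrite big_seq1.
by move=> p; rewrite inE => /eqP->.
Qed.

Lemma tens_span0 X Y : tens_span X Y 0.
Proof. by exists [::]; rewrite ?big_nil. Qed.

Lemma tens_spanD X Y z z' :
  tens_span X Y z -> tens_span X Y z' -> tens_span X Y (z + z').
Proof.
move=> [s sP ->] [s' sP' ->]; exists (s ++ s'); last by rewrite big_cat.
by move=> p; rewrite mem_cat => /orP[/sP|/sP'].
Qed.

Lemma tens_span_sum X Y (T : Type) (s : seq T) (u : T -> tens2 A B) :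
  (forall i, tens_span X Y (u i)) -> tens_span X Y (\sum_(i <- s) u i).
Proof.
by move=> uP; elim/big_ind: _ => //; [exact: tens_span0|exact: tens_spanD].
Qed.

Lemma tens_span_ind X Y (Q : tens2 A B -> Prop) :
  Q 0 -> (forall z z', Q z -> Q z' -> Q (z + z')) ->
  (forall a b, X a -> Y b -> Q (tens_pure a b)) ->
  forall z, tens_span X Y z -> Q z.
Proof.
move=> Q0 QD Qp _ [s sP ->]; rewrite big_seq; elim/big_ind: _ => // p /sP[].
exact: Qp.
Qed.

Lemma tens_spanM X Y X' Y' X'' Y'' z z' :
  (forall a b, X a -> X' b -> X'' (a * b)) ->
  (forall a b, Y a -> Y' b -> Y'' (a * b)) ->
  tens_span X Y z -> tens_span X' Y' z' -> tens_span X'' Y'' (z * z').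
Proof.
move=> XX YY zP zP'; elim/tens_span_ind: zP => [|u v Hu Hv|a b Xa Yb].
- by rewrite mul0r; exact: tens_span0.
- by rewrite mulrDl; exact: tens_spanD.
elim/tens_span_ind: zP' => [|u v Hu Hv|a' b' Xa' Yb'].
- by rewrite mulr0; exact: tens_span0.
- by rewrite mulrDr; exact: tens_spanD.
by rewrite tens_pureM; apply: tens_span_pure; [exact: XX|exact: YY].
Qed.

Lemma tens_span_sub X Y X' Y' z :
  X `<=` X' -> Y `<=` Y' -> tens_span X Y z -> tens_span X' Y' z.
Proof. by move=> XX YY [s sP ->]; exists s => // p /sP[/XX ? /YY]. Qed.

Lemma tens_spanT z : tens_span setT setT z.
Proof. by have [s ->] := tens2_span z; exists s. Qed.

End TensorSpan.

Section Slice.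
Variables (k : fieldType) (A B : algebra k).
Implicit Types (X : set A) (Y : set B) (z : tens2 A B).

Definition is_subspace X : Prop :=
  [/\ X 0, forall x y, X x -> X y -> X (x + y)
    & forall c x, X x -> X (alg_map A c * x)].

Lemma slice_exists (t : B -> k) : functional t ->
  exists2 f : tens2 A B -> A, zmod_morphism f &
    forall a b, f (tens_pure a b) = alg_map A (t b) * a.
Proof.
move=> tf; apply: tens2_balanced; split=> [x x' y|x y y'|c x y].
- by rewrite mulrDr.
- by rewrite tf.1 rmorphD mulrDl.
- by rewrite tf.2 rmorphM mulrCA mulrA.
Qed.

Section SliceDef.
Variables (t : B -> k) (tf : functional t).

(** The map id (x) t, from A (x) B to A. *)
Definition slice : tens2 A B -> A := s2val (cid2 (slice_exists tf)).

Lemma slice_pure a b : slice (tens_pure a b) = alg_map A (t b) * a.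
Proof. exact: (s2valP' (cid2 (slice_exists tf))). Qed.

Lemma slice_zmod : zmod_morphism slice.
Proof. exact: (s2valP (cid2 (slice_exists tf))). Qed.

HB.instance Definition _ := GRing.isZmodMorphism.Build _ _ slice slice_zmod.

Lemma slice_inl a z : slice (tens_inl A B a * z) = a * slice z.
Proof.
have [s ->] := tens2_span z; rewrite mulr_sumr !raddf_sum mulr_sumr.
apply: eq_bigr => p _.
have -> : tens_inl A B a * tens_pure p.1 p.2 = tens_pure (a * p.1) p.2.
  by rewrite /tens_pure rmorphM mulrA.
by rewrite /= !slice_pure mulrCA.
Qed.

Lemma slice_span X Y z : is_subspace X -> tens_span X Y z -> X (slice z).
Proof.
move=> [X0 XD XZ]; elim/tens_span_ind=> [|u v Xu Xv|a b Xa _].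
- by rewrite raddf0.
- by rewrite raddfD; exact: XD.
- by rewrite slice_pure; exact: XZ.
Qed.

End SliceDef.

(** Expand all right-hand components of the tensors z m in one dual basis y; the
coefficients are then the slices of z m. Using the same y for the whole family
is what lets linear conditions on z be tested on the coefficients. *)
Lemma tensor_coordinates (T : finType) Y (z : T -> tens2 A B) :
  (forall m, tens_span setT Y (z m)) ->
  exists N (y : 'I_N -> B) (t : 'I_N -> B -> k) (tf : forall l, functional (t l)),
  [/\ forall l m, t l (y m) = (l == m)%:R, forall l, Y (y l)
    & forall m, z m = \sum_l tens_pure (slice (tf l) (z m)) (y l)].
Proof.
move=> zP.
have /choice[s sP] : forall m, exists s : seq (A * B),
    (forall p, p \in s -> Y p.2) /\ z m = \sum_(p <- s) tens_pure p.1 p.2.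
  by move=> m; have [s sP ->] := zP m; exists s; split=> // p /sP[].
have [N [y [t [tf ty sy ys]]]] :=
  dual_basis (flatten [seq [seq p.2 | p <- s m] | m : T]).
exists N, y, t, tf; split=> // [l|m].
  have /flattenP[_ /mapP[m _ ->] /mapP[p ps ->]] := ys l.
  exact: (sP m).1 ps.
have zE : z m = \sum_(p <- s m) \sum_l tens_pure (alg_map A (t l p.2) * p.1) (y l).
  rewrite (sP m).2 big_seq [RHS]big_seq; apply: eq_bigr => p ps.
  rewrite {1}(sy p.2).
    by rewrite tens_pure_sumr; apply: eq_bigr => l _; rewrite tens_pure_scale.
  apply/flattenP; exists [seq p.2 | p <- s m]; last exact: map_f.
  by apply: map_f; rewrite mem_enum.
rewrite {1}zE exchange_big; apply: eq_bigr => l _ /=.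
rewrite -tens_pure_suml; congr tens_pure.
rewrite (sP m).2 raddf_sum; apply: eq_bigr => p _.
by rewrite /= slice_pure.
Qed.

(** In coordinates with right-hand components in Y, the left-hand components are
slices of z, and these lie in X because z is also in X (x) B. *)
Lemma tens_span_inter X Y Z z : is_subspace X ->
  tens_span X setT z -> tens_span Z Y z -> tens_span X Y z.
Proof.
move=> sX zX zY.
have [//|N [y [t [tf [ty Yy zE]]]]] := @tensor_coordinates unit Y (fun=> z).
  by move=> _; apply: tens_span_sub zY.
rewrite (zE tt); apply: tens_span_sum => l; apply: tens_span_pure => //.
exact: slice_span zX.
Qed.

End Slice.

(** * Finite-dimensional subcomodules *)
Lemma hopf_algebra_neq0 (k : fieldType) (H : hopf_algebra k) : (1 : H) != 0.
Proof.
apply/eqP => /(congr1 (counit H)) /eqP.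
by rewrite rmorph1 rmorph0 oner_eq0.
Qed.

Section Subcomodule.
Variables (k : fieldType) (H : hopf_algebra k).

Lemma map2_pure (A B A' B' : algebra k) (f : alg_hom A A') (g : alg_hom B B') a b :
  map2 f g (tens_pure a b) = tens_pure (f a) (g b).
Proof. by rewrite rmorphM map2l map2r. Qed.

Lemma lift2_pure (A B C : algebra k) (f : alg_hom A C) (g : alg_hom B C) a b :
  lift2 f g (tens_pure a b) = f a * g b.
Proof. by rewrite rmorphM lift2l lift2r. Qed.

Lemma tens_assoc_pure (A B C : algebra k) a b c :
  tens_assoc A B C (tens_pure (tens_pure a b) c) = tens_pure a (tens_pure b c).
Proof.
by rewrite lift2_pure map2_pure /= /tens_pure [in RHS]rmorphM mulrA.
Qed.

(** The map id (x) id (x) t. *)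
Lemma slice_middle (t : H -> k) (tf : functional t) :
  exists2 f : tens2 H (tens2 H H) -> tens2 H H, zmod_morphism f &
    forall x w, f (tens_pure x w) = tens_pure x (slice tf w).
Proof.
apply: tens2_balanced; split=> [x x' w|x w w'|c x w].
- exact: tens_pureDl.
- by rewrite raddfD /= tens_pureDr.
- by rewrite -tens_pure_scale -(hom_alg (tens_inl H H)) slice_inl.
Qed.

Lemma slice_left (A B : algebra k) (t : A -> k) (tf : functional t) :
  exists2 f : tens2 A B -> B, zmod_morphism f &
    forall a b, f (tens_pure a b) = alg_map B (t a) * b.
Proof.
apply: tens2_balanced; split=> [x x' y|x y y'|c x y].
- by rewrite tf.1 rmorphD mulrDl.
- by rewrite mulrDr.
- by rewrite tf.2 rmorphM mulrAC mulrA mulrC mulrA.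
Qed.

Lemma zmod_morphism_sum (U V : zmodType) (f : U -> V) (T : Type) (s : seq T)
    (u : T -> U) : zmod_morphism f ->
  f (\sum_(i <- s) u i) = \sum_(i <- s) f (u i).
Proof.
move=> fB; have f0 : f 0 = 0 by rewrite -(subrr 0) fB subrr.
have fD x y : f (x + y) = f x + f y.
  by rewrite -[in LHS](opprK y) fB -[- y]sub0r fB f0 sub0r opprK.
by elim/big_rec2: _ => [|i y z _ <-].
Qed.

(** Write comul p = sum_l u_l (x) y_l with y part of a dual basis. Coassociativity,
sliced along the l-th functional in the third factor, expresses comul u_l through
the u_m, and p is recovered from the u_l by the counit. *)
Lemma local_finiteness (p : H) : exists s : seq H,
  (forall u, u \in s -> tens_span [set x | x \in s] setT (comul H u)) /\
  (forall X, is_subspace X -> (forall u, u \in s -> X u) -> X p).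
Proof.
have [|N [y [t [tf [ty _ zE]]]]] :=
  @tensor_coordinates k H H unit setT (fun=> comul H p).
  by move=> _; exact: tens_spanT.
pose u l := slice (tf l) (comul H p).
have {}zE : comul H p = \sum_l tens_pure (u l) (y l) := zE tt.
exists [seq u l | l : 'I_N]; split; last first.
  move=> X [X0 XD XZ] Xs; rewrite -(hopf_counitr p) zE rmorph_sum.
  elim/big_ind: _ => // l _; rewrite lift2_pure /= mulrC; apply/XZ/Xs.
  by apply: map_f; rewrite mem_enum.
move=> _ /mapP[l _ ->]; have [f fB fE] := slice_middle (tf l).
have fassoc w b : f (tens_assoc H H H (tens_pure w b)) =
    alg_map (tens2 H H) (t l b) * w.
  have [s ->] := tens2_span w.
  rewrite tens_pure_suml rmorph_sum zmod_morphism_sum // mulr_sumr.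
  apply: eq_bigr => q _; rewrite tens_assoc_pure fE slice_pure.
  by rewrite tens_pure_scale -(hom_alg (tens_inl H H)) /tens_pure rmorphM mulrA.
have -> : comul H (u l) = \sum_m tens_pure (u m) (slice (tf l) (comul H (y m))).
  have := congr1 f (hopf_coassoc p); rewrite zE !rmorph_sum !zmod_morphism_sum //.
  under eq_bigr => m _ do rewrite map2_pure fassoc ty /=.
  under [in X in _ = X -> _]eq_bigr => m _ do rewrite map2_pure fE /=.
  move=> <-; rewrite (bigD1 l) //= eqxx rmorph1 mul1r big1 ?addr0 // => m ml.
  by rewrite eq_sym (negbTE ml) rmorph0 mul0r.
apply: tens_span_sum => m; apply: tens_span_pure => //=.
by apply: map_f; rewrite mem_enum.
Qed.

(** In a basis a of a subcomodule the coefficient matrix c satisfies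
comul c_ij = sum_l c_il (x) c_lj and counit c_ij = delta_ij, so the antipode
inverts it. *)
Lemma subcomodule (ps : seq H) :
  exists N (a : 'I_N -> H) (c : 'I_N -> 'I_N -> H),
  [/\ forall i, comul H (a i) = \sum_j tens_pure (a j) (c j i),
      forall u j, \sum_m antipode H (c u m) * c m j = (u == j)%:R
    & forall p, p \in ps ->
        exists r : 'I_N -> k, p = \sum_i alg_map H (r i) * a i].
Proof.
have [s sP] := choice local_finiteness.
pose us := flatten [seq s p | p <- ps].
have usP u : u \in us -> tens_span [set x | x \in us] setT (comul H u).
  move=> /flattenP[_ /mapP[p pps ->] ups].
  apply: tens_span_sub (_ : [set x | x \in s p] `<=` _) (@subsetT _ _) ((sP p).1 u ups).
  by move=> x /= xs; apply/flattenP; exists (s p) => //; apply: map_f.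
have [N [a [t [tf ta as_ aus]]]] := dual_basis us.
have colP i : exists c : 'I_N -> H, comul H (a i) = \sum_j tens_pure (a j) (c j).
  elim/tens_span_ind: (usP _ (aus i)) => [|z z' [c ->] [c' ->]|x y xs _].
  - by exists (fun=> 0); rewrite big1 // => j _; rewrite /tens_pure rmorph0 mulr0.
  - exists (fun j => c j + c' j); rewrite -big_split; apply: eq_bigr => j _.
    by rewrite tens_pureDr.
  - exists (fun j => alg_map H (t j x) * y); rewrite {1}(as_ _ xs) tens_pure_suml.
    by apply: eq_bigr => j _; rewrite tens_pure_scale.
have [c cP] := choice colP.
exists N, a, (fun j i => c i j); split=> //.
  have counitc l i : counit H (c i l) = (l == i)%:R.
    have := congr1 (t l) (hopf_counitr (a i)).
    rewrite cP rmorph_sum (lin_sum (tf l)) ta => <-.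
    rewrite (bigD1 l) //= lift2_pure /= mulrC (tf l).2 ta eqxx mulr1 big1 ?addr0 //.
    move=> j jl; rewrite lift2_pure /= mulrC (tf l).2 ta eq_sym (negbTE jl).
    by rewrite mulr0.
  have comulc l i : comul H (c i l) = \sum_j tens_pure (c j l) (c i j).
    have [f fB fE] := @slice_left H (tens2 H H) (t l) (tf l).
    have <- : f (map2 (id_hom H) (comul H) (comul H (a i))) = comul H (c i l).
      rewrite cP rmorph_sum zmod_morphism_sum // (bigD1 l) //= map2_pure fE ta.
      rewrite eqxx rmorph1 mul1r big1 ?addr0 // => m ml.
      by rewrite map2_pure fE /= ta eq_sym (negbTE ml) rmorph0 mul0r.
    rewrite -hopf_coassoc cP !rmorph_sum !zmod_morphism_sum //.
    apply: eq_bigr => j _; rewrite map2_pure /= cP tens_pure_suml rmorph_sum.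
    rewrite zmod_morphism_sum // (bigD1 l) //= tens_assoc_pure fE ta eqxx.
    rewrite rmorph1 mul1r big1 ?addr0 // => m ml.
    by rewrite tens_assoc_pure fE ta eq_sym (negbTE ml) rmorph0 mul0r.
  move=> u j; have := hopf_antipodel (c j u).
  rewrite comulc rmorph_sum; under eq_bigr => m _ do rewrite lift2_pure /=.
  by move=> ->; rewrite counitc [LHS]rmorph_nat.
move=> p pps; have [_ pP] := sP p;
apply: (pP [set x | exists r : 'I_N -> k, x = \sum_i alg_map H (r i) * a i]).
  split=> [|x y [r ->] [r' ->]|d x [r ->]].
  - by exists (fun=> 0); rewrite big1 // => i _; rewrite rmorph0 mul0r.
  - exists (fun i => r i + r' i); rewrite -big_split; apply: eq_bigr => i _.
    by rewrite rmorphD mulrDl.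
  - exists (fun i => d * r i); rewrite mulr_sumr; apply: eq_bigr => i _.
    by rewrite rmorphM mulrA.
move=> u up; exists (fun i => t i u); apply: as_.
by apply/flattenP; exists (s p) => //; apply: map_f.
Qed.

End Subcomodule.

(** * Hopf subalgebras are locally direct summands *)
Section DetExpansion.
Variables (R : comPzRingType) (t : nat) (J : finType).

Lemma det_expand_rows (w : 'I_t -> J -> R) (M : 'I_t -> J -> 'I_t -> R) :
  \det (\matrix_(i, j) \sum_l w i l * M i l j) =
  \sum_(h : {ffun 'I_t -> J})
    (\prod_i w i (h i)) * \det (\matrix_(i, j) M i (h i) j).
Proof.
rewrite /determinant; under eq_bigr => s _.
  under eq_bigr => i _ do rewrite mxE.
  rewrite bigA_distr_bigA mulr_sumr.
  over.
rewrite exchange_big; apply: eq_bigr => h _; rewrite mulr_sumr.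
apply: eq_bigr => s _; rewrite big_split mulrCA; congr (_ * (_ * _)).
by apply: eq_bigr => i _; rewrite mxE.
Qed.

Lemma det_expand_cols (w : 'I_t -> J -> R) (M : 'I_t -> J -> R) :
  \det (\matrix_(i, j) \sum_l w j l * M i l) =
  \sum_(h : {ffun 'I_t -> J})
    (\prod_j w j (h j)) * \det (\matrix_(i, j) M i (h j)).
Proof.
rewrite -det_tr.
have -> : (\matrix_(i, j) \sum_l w j l * M i l)^T =
    \matrix_(j, i) \sum_l w j l * (fun j l i => M i l) j l i.
  by apply/matrixP=> i j; rewrite !mxE.
rewrite det_expand_rows; apply: eq_bigr => h _; rewrite -det_tr.
by congr (_ * \det _); apply/matrixP=> i j; rewrite !mxE.
Qed.

End DetExpansion.

Section LocalRetraction.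
Variables (k : fieldType) (H : hopf_algebra k) (D : set H).
Hypothesis Dcst : forall c, D (alg_map H c).
Hypothesis DD : forall x y, D x -> D y -> D (x + y).
Hypothesis DM : forall x y, D x -> D y -> D (x * y).
Hypothesis DS : forall x, D x -> D (antipode H x).
Hypothesis Dcomul : forall x, D x -> tens_span D D (comul H x).

Let D0 : D 0. Proof. by rewrite -(rmorph0 (alg_map H)). Qed.
Let D1 : D 1. Proof. by rewrite -(rmorph1 (alg_map H)). Qed.
Let DN x : D x -> D (- x).
Proof. by rewrite -mulN1r -(rmorphN1 (alg_map H)) => /(DM (Dcst _)). Qed.
Let Dsum (T : Type) (s : seq T) (u : T -> H) :
  (forall i, D (u i)) -> D (\sum_(i <- s) u i).
Proof. by move=> uD; elim/big_ind: _. Qed.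
Let Dsubspace : is_subspace D.
Proof. by split=> // c x; apply: DM. Qed.

Let Dsign n : D ((-1) ^+ n).
Proof. by elim: n => [|n IH]; rewrite ?expr0 // exprS mulN1r; exact: DN. Qed.
Let Ddet t (M : 'M[H]_t) : (forall i j, D (M i j)) -> D (\det M).
Proof.
move=> MD; apply: Dsum => s; apply: DM; last by elim/big_ind: _.
exact: Dsign.
Qed.

Variables (N : nat) (a : 'I_N -> H) (c : 'I_N -> 'I_N -> H).
Hypothesis aE : forall i, comul H (a i) = \sum_j tens_pure (a j) (c j i).
Hypothesis cV : forall u j, \sum_m antipode H (c u m) * c m j = (u == j)%:R.

(** The D-module of relations among the classes of the a_i modulo D. *)
Definition relations (d : 'I_N -> H) : Prop :=
  (forall i, D (d i)) /\ D (\sum_i d i * a i).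

Definition minor t (r : 'I_t -> 'I_N -> H) (f : 'I_t -> 'I_N) : H :=
  \det (\matrix_(i, j) r i (f j)).

(** The ideal of D generated by the t by t minors of relations, as the smallest
set closed under the ideal operations of D, so that membership is its own
induction principle. *)
Definition minor_ideal t : set H :=
  [set x | forall X : set H, X 0 -> (forall y z, X y -> X z -> X (y + z)) ->
     (forall d y, D d -> X y -> X (d * y)) ->
     (forall r f, (forall i, relations (r i)) -> X (@minor t r f)) -> X x].

Lemma minor_ideal_minor t r f :
  (forall i, relations (r i)) -> minor_ideal t (@minor t r f).
Proof. by move=> rK X _ _ _; exact. Qed.

Lemma minor_ideal0 t : minor_ideal t 0.
Proof. by move=> X. Qed.

Lemma minor_idealD t x y : minor_ideal t x -> minor_ideal t y ->
  minor_ideal t (x + y).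
Proof. by move=> xF yF X X0 XD XM Xm; apply: (XD); [exact: xF|exact: yF]. Qed.

Lemma minor_idealM t d x : D d -> minor_ideal t x -> minor_ideal t (d * x).
Proof. by move=> dD xF X X0 XD XM Xm; apply: (XM) => //; exact: xF. Qed.

Lemma minor_ideal_sub t : minor_ideal t `<=` D.
Proof.
move=> x; apply=> // r f rK.
by apply: Ddet => i j; rewrite mxE; exact: (rK i).1.
Qed.

Lemma minor_ideal_subspace t : is_subspace (minor_ideal t).
Proof.
split=> [|x y|e x]; [exact: minor_ideal0|exact: minor_idealD|].
exact: minor_idealM.
Qed.

Lemma relationsD d e : relations d -> relations e ->
  relations (fun i => d i + e i).
Proof.
move=> [dD da] [eD ea]; split=> [i|]; first exact: DD.
by under eq_bigr => i _ do rewrite mulrDl; rewrite big_split; exact: DD.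
Qed.

Lemma relationsZ x d : D x -> relations d -> relations (fun i => x * d i).
Proof.
move=> xD [dD da]; split=> [i|]; first exact: DM.
by under eq_bigr => i _ do rewrite -mulrA; rewrite -mulr_sumr; exact: DM.
Qed.

Lemma relations_sum (T : Type) (s : seq T) (d : T -> 'I_N -> H) :
  (forall l, relations (d l)) -> relations (fun i => \sum_(l <- s) d l i).
Proof.
move=> dK; split=> [i|]; first by apply: Dsum => l; exact: (dK l).1.
under eq_bigr => i _ do rewrite mulr_suml.
by rewrite exchange_big; apply: Dsum => l; exact: (dK l).2.
Qed.

(** The coordinates of comul applied to d, read in the basis a after the
coefficient matrix of comul a has been absorbed; [slice_translate] shows that
they are again relations, with coefficients in the second factor. *)
Definition translate (d : 'I_N -> H) (m : 'I_N) : tens2 H H :=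
  \sum_j comul H (d j) * tens_inr H H (c m j).

(** The antipode of the coefficient matrix is its inverse. *)
Lemma translateK d u :
  comul H (d u) =
  \sum_m tens_inr H H (antipode H (c u m)) * translate d m.
Proof.
under eq_bigr => m _ do rewrite /translate mulr_sumr.
rewrite exchange_big (bigD1 u) //= [X in _ + X]big1 ?addr0 => [|j ju].
  under eq_bigr => m _ do rewrite mulrCA -rmorphM.
  by rewrite -mulr_sumr -rmorph_sum cV eqxx rmorph1 mulr1.
under eq_bigr => m _ do rewrite mulrCA -rmorphM.
by rewrite -mulr_sumr -rmorph_sum cV eq_sym (negbTE ju) rmorph0 mulr0.
Qed.

Lemma tens_pure1 (A B : algebra k) (b : B) : tens_inr A B b = tens_pure 1 b.
Proof. by rewrite /tens_pure rmorph1 mul1r. Qed.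

Lemma translate_span d m : (forall i, D (d i)) ->
  tens_span D setT (translate d m).
Proof.
move=> dD; apply: tens_span_sum => j.
apply: (tens_spanM (X' := [set 1]) (Y' := setT)) (Dcomul (dD j)) _ => //.
  by move=> x _ xD ->; rewrite mulr1.
by rewrite tens_pure1; apply: tens_span_pure.
Qed.

(** Apply comul to the membership of sum_i d_i a_i in D: the resulting sum lies in
D (x) D, so each of its slices lies in D. *)
Lemma slice_translate d (th : H -> k) (tf : functional th) :
  relations d -> relations (fun m => slice tf (translate d m)).
Proof.
move=> [dD da]; split=> [m|].
  exact: slice_span (translate_span m dD).
suff -> : \sum_m slice tf (translate d m) * a m =
    slice tf (comul H (\sum_i d i * a i)).
  exact: slice_span (Dcomul da).
under eq_bigr => m _ do rewrite mulrC -slice_inl.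
rewrite -raddf_sum /=; congr (slice tf _).
rewrite rmorph_sum; under eq_bigr => m _ do rewrite /translate mulr_sumr.
rewrite exchange_big; apply: eq_bigr => j _; rewrite rmorphM aE mulr_sumr.
by apply: eq_bigr => m _; rewrite mulrCA.
Qed.

(** The comultiplication of a minor is the minor of the comultiplied entries.
[translateK] rewrites the entries through relations with coefficients in the
second factor, and multilinearity in columns and then in rows exhibits the
determinant as a combination of minors of relations. *)
Lemma minor_ideal_costable t x : minor_ideal t x ->
  tens_span (minor_ideal t) setT (comul H x).
Proof.
move=> xF; apply: (xF [set y | tens_span (minor_ideal t) setT (comul H y)]) =>
  /= [|y z yP zP|d y dD yP|r f rK].
- by rewrite rmorph0; exact: tens_span0.
- by rewrite rmorphD; exact: tens_spanD.
- rewrite rmorphM; apply: tens_spanM (Dcomul dD) yP => // u v.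
  exact: minor_idealM.
have [|L [y [th [tf [_ _ zE]]]]] := @tensor_coordinates k H H _ setT
    (fun p : 'I_t * 'I_N => translate (r p.1) p.2).
  by move=> p; exact: tens_spanT.
pose r' i l m := slice (tf l) (translate (r i) m).
have r'K i l : relations (r' i l) by apply: slice_translate.
rewrite /minor -det_map_mx.
have -> : map_mx (comul H) (\matrix_(i, j) r i (f j)) = \matrix_(i, j)
    \sum_m tens_inr H H (antipode H (c (f j) m)) * translate (r i) m.
  by apply/matrixP=> i j; rewrite !mxE translateK.
rewrite det_expand_cols; apply: tens_span_sum => g.
rewrite -rmorph_prod.
have -> : \matrix_(i, j) translate (r i) (g j) = \matrix_(i, j)
    \sum_l tens_inr H H (y l) * tens_inl H H (r' i l (g j)).
  apply/matrixP=> i j; rewrite !mxE (zE (i, g j)).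
  by apply: eq_bigr => l _; rewrite mulrC.
rewrite (det_expand_rows (fun=> _) (fun i l j => tens_inl H H (r' i l (g j)))).
rewrite mulr_sumr; apply: tens_span_sum => h; rewrite -!rmorph_prod mulrA -rmorphM.
have -> : \matrix_(i, j) tens_inl H H (r' i (h i) (g j)) =
    map_mx (tens_inl H H) (\matrix_(i, j) r' i (h i) (g j)).
  by apply/matrixP=> i j; rewrite !mxE.
rewrite det_map_mx mulrC; apply: tens_span_pure => //.
by apply: (@minor_ideal_minor t (fun i => r' i (h i)) g) => i.
Qed.

(** A nonzero stable ideal F of D is D: by the counit axiom some y in F has
counit 1, and then 1 = sum y_1 S(y_2) lies in F since comul y is in F (x) D. *)
Lemma minor_ideal_unit t x : minor_ideal t x -> x <> 0 -> minor_ideal t 1.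
Proof.
move=> xF x0; set F := minor_ideal t.
have FP z : F z -> tens_span F D (comul H z).
  move=> zF; have zD : D z by exact: minor_ideal_sub zF.
  apply: tens_span_inter (minor_ideal_subspace t) _ (Dcomul zD).
  exact: minor_ideal_costable zF.
have [y Fy y1] : exists2 y, F y & counit H y = 1.
  apply: contrapT => nF; apply: x0.
  have F0 z : F z -> counit H z = 0.
    move=> Fz; apply/eqP; apply: contraT => z0; exfalso; apply: nF.
    exists (alg_map H (counit H z)^-1 * z); first exact: minor_idealM.
    by rewrite rmorphM hom_alg /= mulVf.
  rewrite -(hopf_counitl x); elim/tens_span_ind: (FP _ xF).
  - by rewrite rmorph0.
  - by move=> u v u0 v0; rewrite rmorphD u0 v0 addr0.
  - by move=> u v /F0 u0 _; rewrite lift2_pure /= u0 rmorph0 mul0r.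
rewrite -(rmorph1 (unit_hom H)) -y1 -hopf_antipoder.
elim/tens_span_ind: (FP _ Fy).
- by rewrite rmorph0; exact: minor_ideal0.
- by move=> u v uF vF; rewrite rmorphD; exact: minor_idealD.
- move=> u v uF vD; rewrite lift2_pure /= mulrC.
  by apply: minor_idealM => //; exact: DS.
Qed.

(** Minors of size 0 are 1, and those of size N + 1 have a repeated column. *)
Lemma maximal_minors : exists t, minor_ideal t 1 /\
  forall x, minor_ideal t.+1 x -> x = 0.
Proof.
apply: contrapT => nt.
have all1 t : minor_ideal t 1.
  elim: t => [|t IH].
    have f : 'I_0 -> 'I_N by case.
    have := @minor_ideal_minor 0 (fun i => match i with Ordinal _ _ => fun=> 0 end) f.
    by rewrite /minor det_mx00; apply; case.
  apply: contrapT => n1; apply: nt; exists t; split=> // x xF.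
  by apply: contrapT => x0; apply: n1; exact: minor_ideal_unit xF x0.
suff H0 : (1 : H) = 0 by have := hopf_algebra_neq0 H; rewrite H0 eqxx.
apply: (all1 N.+1 [set x | x = 0]) => //= [y z -> ->|d y _ ->|r f _].
- by rewrite addr0.
- by rewrite mulr0.
have /injectivePn[i [j ij fij]] : ~~ injectiveb f.
  apply/negP=> /injectiveP /leq_card; rewrite !card_ord.
  by rewrite ltnn.
rewrite /minor -det_tr; apply: (determinant_alternate ij) => l.
by rewrite !mxE fij.
Qed.

(** A D-linear map from D^N to the relations that is multiplication by x on the
relations. *)
Definition scaled_projection (x : H) (pr : ('I_N -> H) -> 'I_N -> H) : Prop :=
  [/\ forall v w i, pr (fun i => v i + w i) i = pr v i + pr w i,
      forall d v i, pr (fun i => d * v i) i = d * pr v i,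
      forall v, (forall i, D (v i)) -> relations (pr v)
    & forall v i, relations v -> pr v i = x * v i].

(** Border the t by t submatrix of rows r and columns f with a new row v and a new
column j. Expanding along the column, the determinant is (minor r f) v_j plus a
combination of the r_i j with coefficients independent of j; hence
(minor r f) v minus the determinants is a relation. When v is a relation, the
determinants are minors of size t + 1, so they vanish. *)
Lemma cramer_projection t r f : (forall i, relations (r i)) ->
  (forall x, minor_ideal t.+1 x -> x = 0) ->
  exists pr, scaled_projection (@minor t r f) pr.
Proof.
move=> rK maxt.
pose rows v (i : 'I_t.+1) := oapp r v (unlift ord0 i).
pose cols j (i : 'I_t.+1) := oapp f j (unlift ord0 i).
pose M v j : 'M[H]_t.+1 := \matrix_(i, l) rows v i (cols j l).
have rows0 v : rows v ord0 = v by rewrite /rows unlift_none.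
have rowsS v i : rows v (lift ord0 i) = r i by rewrite /rows liftK.
have ME v j : minor r f * v j - \det (M v j) =
    \sum_i - cofactor (M v j) (lift ord0 i) ord0 * r i j.
  rewrite (expand_det_col _ ord0) big_ord_recl mxE rows0 /cols unlift_none /=.
  have -> : cofactor (M v j) ord0 ord0 = minor r f.
    rewrite /cofactor expr0 mul1r; congr (\det _).
    by apply/matrixP=> i l; rewrite !mxE rowsS /cols liftK.
  rewrite mulrC opprD addNKr -sumrN; apply: eq_bigr => i _.
  by rewrite mxE rowsS mulrC mulNr /cols unlift_none.
have cofE v j j' i :
    cofactor (M v j) (lift ord0 i) ord0 = cofactor (M v j') (lift ord0 i) ord0.
  rewrite /cofactor; congr (_ * \det _).
  by apply/matrixP=> l m; rewrite !mxE /cols liftK.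
exists (fun v j => minor r f * v j - \det (M v j)); split.
- move=> v w j; rewrite mulrDr addrACA -opprD; congr (_ - _).
  rewrite (@determinant_multilinear _ _ _ (M v j) (M w j) ord0 1 1) ?mul1r //.
  + by apply/rowP=> l; rewrite !mxE !rows0 !mul1r.
  + by apply/matrixP=> i l; rewrite !mxE !rowsS.
  + by apply/matrixP=> i l; rewrite !mxE !rowsS.
- move=> d v j; rewrite mulrBr mulrCA; congr (_ - _).
  rewrite (@determinant_multilinear _ _ _ (M v j) (M v j) ord0 d 0).
  + by rewrite mul0r addr0.
  + by apply/rowP=> l; rewrite !mxE !rows0 mul0r addr0.
  + by apply/matrixP=> i l; rewrite !mxE !rowsS.
  + by apply/matrixP=> i l; rewrite !mxE !rowsS.
- move=> v vD.
  have [j0|noj] := pselect (exists j : 'I_N, True); last first.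
    split=> [i|]; first by exfalso; apply: noj; exists i.
    by rewrite big1 // => i; exfalso; apply: noj; exists i.
  case: j0 => j0 _.
  have -> : (fun j => minor r f * v j - \det (M v j)) = (fun j =>
      \sum_i - cofactor (M v j0) (lift ord0 i) ord0 * r i j).
    by apply/funext=> j; rewrite ME; apply: eq_bigr => i _; rewrite (cofE v j j0).
  apply: relations_sum => i; apply: relationsZ => //; apply: DN.
  rewrite /cofactor; apply: DM; first exact: Dsign.
  apply: Ddet => l m; rewrite !mxE /rows.
  by case: (unlift _ _) => [q|] //=; exact: (rK q).1.
- move=> v j vK; rewrite (maxt (\det (M v j))) ?subr0 //.
  apply: (@minor_ideal_minor t.+1 (rows v) (cols j)) => i; rewrite /rows.
  by case: (unlift _ _) => [q|] /=.
Qed.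

Lemma relations_projection : exists pr, scaled_projection 1 pr.
Proof.
have [t [F1 maxt]] := maximal_minors.
apply: (F1 [set x | exists pr, scaled_projection x pr]) => /=.
- exists (fun _ _ => 0); split=> //.
  + by move=> v w i; rewrite addr0.
  + by move=> d v i; rewrite mulr0.
  + by move=> v vD; split=> //; rewrite big1 // => i _; rewrite mul0r.
  + by move=> v i vK; rewrite mul0r.
- move=> y z [p [p1 p2 p3 p4]] [q [q1 q2 q3 q4]].
  exists (fun v i => p v i + q v i); split.
  + by move=> v w i; rewrite p1 q1 addrACA.
  + by move=> d v i; rewrite p2 q2 mulrDr.
  + by move=> v vD; apply: relationsD; [exact: p3|exact: q3].
  + by move=> v i vK; rewrite p4 // q4 // mulrDl.
- move=> d y dD [p [p1 p2 p3 p4]]; exists (fun v i => d * p v i); split.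
  + by move=> v w i; rewrite p1 mulrDr.
  + by move=> e v i; rewrite p2 mulrCA.
  + by move=> v vD; apply: relationsZ => //; exact: p3.
  + by move=> v i vK; rewrite p4 // mulrA.
- by move=> r f rK; exact: cramer_projection.
Qed.

End LocalRetraction.

Section HopfSubalgebra.
Variables (k : fieldType) (H : hopf_algebra k) (D : set H).
Hypothesis Dcst : forall c, D (alg_map H c).
Hypothesis DD : forall x y, D x -> D y -> D (x + y).
Hypothesis DM : forall x y, D x -> D y -> D (x * y).
Hypothesis DS : forall x, D x -> D (antipode H x).
Hypothesis Dcomul : forall x, D x -> tens_span D D (comul H x).

(** The set W is the graph of the retraction from D + sum_i D a_i to D that sends
d_0 + sum_i d_i a_i to d_0 + sum_i pr(d)_i a_i, where pr projects D^N onto the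
relations. It is single-valued because d is a relation, hence fixed by pr, when
d_0 + sum_i d_i a_i = 0. *)
Lemma hopf_subalgebra_retraction (ps : seq H) : exists W : set (H * H),
  [/\ W (1, 1), forall x y x' y', W (x, y) -> W (x', y') -> W (x + x', y + y'),
      forall d x y, D d -> W (x, y) -> W (d * x, d * y),
      forall x y, W (x, y) -> D y /\ (x = 0 -> y = 0)
    & forall p, p \in ps -> exists y, W (p, y)].
Proof.
have [N [a [c [aE cV psP]]]] := subcomodule ps.
have [pr [pD pM pK p1]] := relations_projection Dcst DD DM DS Dcomul aE cV.
have D0 : D 0 by rewrite -(rmorph0 (alg_map H)).
have D1 : D 1 by rewrite -(rmorph1 (alg_map H)).
have pr0 i : pr (fun=> 0) i = 0.
  have -> : (fun=> 0) = (fun _ : 'I_N => 0 * 0 :> H).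
    by apply/funext=> j; rewrite mul0r.
  by rewrite (pM 0 (fun=> 0)) mul0r.
exists [set q : H * H | exists d0 (d : 'I_N -> H), [/\ D d0, forall i, D (d i),
  q.1 = d0 + \sum_i d i * a i & q.2 = d0 + \sum_i pr d i * a i]]; split=> /=.
- exists 1, (fun=> 0); split=> //; rewrite big1 ?addr0 // => i _.
    by rewrite mul0r.
  by rewrite pr0 mul0r.
- move=> x y x' y' [d0 [d [d0D dD -> ->]]] [e0 [e [e0D eD -> ->]]].
  exists (d0 + e0), (fun i => d i + e i); split.
  + exact: DD.
  + by move=> i; exact: DD.
  + by rewrite addrACA -big_split; congr (_ + _); apply: eq_bigr => i _; rewrite mulrDl.
  + rewrite addrACA -big_split; congr (_ + _); apply: eq_bigr => i _.
    by rewrite pD mulrDl.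
- move=> e x y eD [d0 [d [d0D dD -> ->]]].
  exists (e * d0), (fun i => e * d i); split.
  + exact: DM.
  + by move=> i; exact: DM.
  + by rewrite mulrDr mulr_sumr; congr (_ + _); apply: eq_bigr => i _; rewrite mulrA.
  + rewrite mulrDr mulr_sumr; congr (_ + _); apply: eq_bigr => i _.
    by rewrite pM mulrA.
- move=> x y [d0 [d [d0D dD -> ->]]].
  split; first by apply: DD => //; exact: (pK d dD).2.
  move=> d0E; have dN : \sum_i d i * a i = - d0.
    by apply/eqP; rewrite -addr_eq0 addrC d0E.
  have dK : relations D a d.
    by split=> //; rewrite dN -mulN1r -(rmorphN1 (alg_map H)); exact: DM.
  by under eq_bigr => i _ do rewrite p1 // mul1r.
- move=> p /psP[r ->]; exists (0 + \sum_i pr (fun i => alg_map H (r i)) i * a i).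
  by exists 0, (fun i => alg_map H (r i)); split=> //; rewrite add0r.
Qed.

End HopfSubalgebra.

(** * Ideals and quotient algebras *)
Section IdealGen.
Variable (R : comPzRingType).
Implicit Types (S J : set R).

Lemma ideal_gen_ideal S : is_ideal (ideal_gen S).
Proof.
split=> [J [[J0 _ _] _]//|x y xS yS J JS|b x xS J JS].
  by have [[_ JD _] _] := JS; apply: JD; [exact: xS|exact: yS].
by have [[_ _ JM] _] := JS; apply: JM; exact: xS.
Qed.

Lemma ideal_gen_sub S : S `<=` ideal_gen S.
Proof. by move=> x Sx J [_]; apply. Qed.

Lemma ideal_gen_min S J : is_ideal J -> S `<=` J -> ideal_gen S `<=` J.
Proof. by move=> iJ SJ x; apply. Qed.

Lemma idealN J x : is_ideal J -> J x -> J (- x).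
Proof. by move=> [_ _ JM] /(JM (-1)); rewrite mulN1r. Qed.

Lemma ideal_preimage (R' : comPzRingType) (f : {rmorphism R' -> R}) J :
  is_ideal J -> is_ideal [set x | J (f x)].
Proof.
move=> [J0 JD JM]; split=> [|x y|b x] /=; rewrite ?rmorph0 ?rmorphD ?rmorphM //.
  exact: JD.
exact: JM.
Qed.

End IdealGen.

Section Quotient.
Variables (R : comPzRingType) (J : set R) (iJ : is_ideal J).

Definition congr_mod (x y : R) : bool := `[< J (x - y) >].

Lemma congr_mod_refl : reflexive congr_mod.
Proof. by move=> x; apply/asboolP; rewrite subrr; case: iJ. Qed.
Lemma congr_mod_sym : ssrbool.symmetric congr_mod.
Proof.
by move=> x y; apply/asboolP/asboolP => /(idealN iJ); rewrite opprB.
Qed.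
Lemma congr_mod_trans : transitive congr_mod.
Proof.
move=> y x z /asboolP xy /asboolP yz; apply/asboolP.
by rewrite -(subrK y x) -addrA; case: iJ => _ JD _; exact: JD.
Qed.

Canonical congr_mod_equiv :=
  EquivRel congr_mod congr_mod_refl congr_mod_sym congr_mod_trans.

Definition quot_ring : Type := {eq_quot congr_mod_equiv}%qT.
HB.instance Definition _ := Choice.on quot_ring.
HB.instance Definition _ := EqQuotient.on quot_ring.

Definition quot_class (x : R) : quot_ring := (\pi_quot_ring x)%qT.

Lemma quot_class_eq x y : quot_class x = quot_class y <-> J (x - y).
Proof. by split=> [/eqquotP/asboolP|xy] //; apply/eqquotP/asboolP. Qed.

Lemma quot_class_surj (u : quot_ring) : exists x, u = quot_class x.
Proof. by exists (repr u)%qT; rewrite /quot_class reprK. Qed.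

Lemma repr_quot_class x : J (repr (quot_class x) - x)%qT.
Proof. by apply/quot_class_eq; rewrite /quot_class reprK. Qed.

Definition quot_add (u v : quot_ring) := quot_class (repr u + repr v)%qT.
Definition quot_opp (u : quot_ring) := quot_class (- repr u)%qT.
Definition quot_mul (u v : quot_ring) := quot_class (repr u * repr v)%qT.

Lemma quot_addE x y : quot_add (quot_class x) (quot_class y) = quot_class (x + y).
Proof.
apply/quot_class_eq; rewrite opprD addrACA.
by case: iJ => _ JD _; apply: JD; exact: repr_quot_class.
Qed.
Lemma quot_oppE x : quot_opp (quot_class x) = quot_class (- x).
Proof.
by apply/quot_class_eq; rewrite -opprD; exact/(idealN iJ)/repr_quot_class.
Qed.
Lemma quot_mulE x y : quot_mul (quot_class x) (quot_class y) = quot_class (x * y).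
Proof.
apply/quot_class_eq; set x' := repr _; set y' := repr _.
have -> : x' * y' - x * y = y' * (x' - x) + x * (y' - y).
  by rewrite !mulrBr [y' * x']mulrC [y' * x]mulrC addrA subrK.
by case: iJ => _ JD JM; apply: JD; apply: JM; exact: repr_quot_class.
Qed.

Lemma quot_addA : associative quot_add.
Proof.
move=> u v w; have [[[x ->] [y ->]] [z ->]] :=
  (quot_class_surj u, quot_class_surj v, quot_class_surj w).
by rewrite !quot_addE addrA.
Qed.
Lemma quot_addC : commutative quot_add.
Proof. by move=> u v; rewrite /quot_add addrC. Qed.
Lemma quot_add0 : left_id (quot_class 0) quot_add.
Proof.
by move=> u; have [x ->] := quot_class_surj u; rewrite quot_addE add0r.
Qed.
Lemma quot_addN : left_inverse (quot_class 0) quot_opp quot_add.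
Proof.
move=> u; have [x ->] := quot_class_surj u.
by rewrite quot_oppE quot_addE addNr.
Qed.
Lemma quot_mulA : associative quot_mul.
Proof.
move=> u v w; have [[[x ->] [y ->]] [z ->]] :=
  (quot_class_surj u, quot_class_surj v, quot_class_surj w).
by rewrite !quot_mulE mulrA.
Qed.
Lemma quot_mulC : commutative quot_mul.
Proof. by move=> u v; rewrite /quot_mul mulrC. Qed.
Lemma quot_mul1 : left_id (quot_class 1) quot_mul.
Proof.
by move=> u; have [x ->] := quot_class_surj u; rewrite quot_mulE mul1r.
Qed.
Lemma quot_mulDl : left_distributive quot_mul quot_add.
Proof.
move=> u v w; have [[[x ->] [y ->]] [z ->]] :=
  (quot_class_surj u, quot_class_surj v, quot_class_surj w).
by rewrite !(quot_mulE, quot_addE) mulrDl.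
Qed.

HB.instance Definition _ := GRing.isZmodule.Build quot_ring
  quot_addA quot_addC quot_add0 quot_addN.
HB.instance Definition _ := GRing.Zmodule_isComPzRing.Build quot_ring
  quot_mulA quot_mulC quot_mul1 quot_mulDl.

Lemma quot_class_zmod : zmod_morphism quot_class.
Proof. by move=> x y; rewrite -quot_addE -quot_oppE. Qed.
Lemma quot_class_monoid : monoid_morphism quot_class.
Proof. by split=> // x y; rewrite -quot_mulE. Qed.

HB.instance Definition _ := GRing.isZmodMorphism.Build R quot_ring quot_class
  quot_class_zmod.
HB.instance Definition _ := GRing.isMonoidMorphism.Build R quot_ring quot_class
  quot_class_monoid.

End Quotient.

Section QuotientAlgebra.
Variables (k : comPzRingType).

Lemma quotient_algebra (A : algebra k) (J : set A) : is_ideal J ->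
  exists (Q : algebra k) (p : alg_hom A Q),
    (forall u, exists x, u = p x) /\ (forall x, p x = 0 <-> J x).
Proof.
move=> iJ; pose q : {rmorphism A -> quot_ring iJ} := quot_class iJ.
exists (Algebra (q \o alg_map A : {rmorphism k -> quot_ring iJ})).
exists (@AlgHom k A (Algebra (q \o alg_map A : {rmorphism k -> quot_ring iJ}))
  q (fun=> erefl)); split; first exact: quot_class_surj.
move=> x; rewrite -(rmorph0 q); split=> /= [/quot_class_eq|Jx].
  by rewrite subr0.
by apply/quot_class_eq; rewrite subr0.
Qed.

Lemma factor_surjection (A Q B : algebra k) (p : alg_hom A Q) (f : alg_hom A B) :
  (forall u, exists x, u = p x) -> (forall x, p x = 0 -> f x = 0) ->
  exists g : alg_hom Q B, forall x, g (p x) = f x.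
Proof.
move=> /choice[s sK] pf.
have E x : f (s (p x)) = f x.
  by apply/subr0_eq; rewrite -rmorphB; apply: pf; rewrite rmorphB -sK subrr.
have gB : zmod_morphism (f \o s).
  by move=> u v /=; rewrite {1}(sK u) {1}(sK v) -rmorphB E rmorphB.
have gM : monoid_morphism (f \o s).
  split=> [|u v] /=; first by rewrite -(rmorph1 p) E rmorph1.
  by rewrite {1}(sK u) {1}(sK v) -rmorphM E rmorphM.
pose g0 : Q -> B := f \o s.
pose mz := GRing.isZmodMorphism.Build Q B g0 gB.
pose mm := GRing.isMonoidMorphism.Build Q B g0 gM.
pose g : {rmorphism Q -> B} := HB.pack g0 mz mm.
have gk c : g (alg_map Q c) = alg_map B c.
  by rewrite -(hom_alg p) [LHS]E hom_alg.
by exists (AlgHom gk).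
Qed.

End QuotientAlgebra.

(** * Points of affine group schemes *)
Section Convolution.
Variables (k : comPzRingType) (P : hopf_algebra k) (R : algebra k).
Implicit Types f g h : alg_hom P R.

(** The product of two R-valued points of the group scheme with coordinate ring
P. *)
Definition conv f g : alg_hom P R := comp_hom (lift2 f g) (comul P).

(** The R-valued point f lies in the closed subscheme defined by J. *)
Definition kills (J : set P) f : Prop := forall x, J x -> f x = 0.

Lemma lift2_comp (A B A' B' C : algebra k) (f : alg_hom A' C) (g : alg_hom B' C)
    (f' : alg_hom A A') (g' : alg_hom B B') x :
  lift2 f g (map2 f' g' x) = lift2 (comp_hom f f') (comp_hom g g') x.
Proof.
apply: (ext2 (g := comp_hom (lift2 f g) (map2 f' g'))) x => x /=.
  by rewrite map2l !lift2l.
by rewrite map2r !lift2r.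
Qed.

Lemma comp_lift2 (A B C C' : algebra k) (f : alg_hom A C) (g : alg_hom B C)
    (h : alg_hom C C') x :
  h (lift2 f g x) = lift2 (comp_hom h f) (comp_hom h g) x.
Proof.
apply: (ext2 (g := comp_hom h (lift2 f g))) x => x /=.
  by rewrite !lift2l.
by rewrite !lift2r.
Qed.

Lemma eq_lift2 (A B C : algebra k) (f f' : alg_hom A C) (g g' : alg_hom B C) :
  f =1 f' -> g =1 g' -> lift2 f g =1 lift2 f' g'.
Proof.
move=> ff gg; apply: (ext2 (g := lift2 f g) (h := lift2 f' g')) => x.
  by rewrite !lift2l.
by rewrite !lift2r.
Qed.

Lemma lift2_assoc (A B C : algebra k) (f : alg_hom A R) (g : alg_hom B R)
    (h : alg_hom C R) x :
  lift2 (lift2 f g) h x = lift2 f (lift2 g h) (tens_assoc A B C x).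
Proof.
apply: (ext2 (h := comp_hom (lift2 f (lift2 g h)) (tens_assoc A B C))) x => x.
  rewrite lift2l /= /tens_assoc lift2l lift2_comp.
  by apply: eq_lift2 => y //=; rewrite lift2l.
by rewrite lift2r /= /tens_assoc lift2r /= !lift2r.
Qed.

Lemma convA f g h : conv f (conv g h) =1 conv (conv f g) h.
Proof.
move=> x /=.
have -> : lift2 f (conv g h) (comul P x) =
    lift2 f (lift2 g h) (map2 (id_hom P) (comul P) (comul P x)).
  by rewrite lift2_comp; apply: eq_lift2.
have -> : lift2 (conv f g) h (comul P x) =
    lift2 (lift2 f g) h (map2 (comul P) (id_hom P) (comul P x)).
  by rewrite lift2_comp; apply: eq_lift2.
by rewrite lift2_assoc hopf_coassoc.
Qed.

Definition conv_unit : alg_hom P R := comp_hom (unit_hom R) (counit P).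

Lemma conv1f f : conv conv_unit f =1 f.
Proof.
move=> x; rewrite -[in RHS](hopf_counitl x) comp_lift2.
by apply: eq_lift2 => c //=; rewrite hom_alg.
Qed.

Lemma convfV f : conv f (comp_hom f (antipode P)) =1 conv_unit.
Proof.
move=> x; rewrite /= -[RHS](hom_alg f) -[alg_map P _]hopf_antipoder comp_lift2.
exact: eq_lift2.
Qed.

Lemma eq_conv f f' g g' : f =1 f' -> g =1 g' -> conv f g =1 conv f' g'.
Proof. by move=> ff gg x; exact: eq_lift2. Qed.

Lemma kills_conv (J : set P) f g :
  (forall x, J x -> tens_ideal J (comul P x)) ->
  kills J f -> kills J g -> kills J (conv f g).
Proof.
move=> JC fJ gJ x /JC[s sP] /= ->; rewrite rmorph_sum big_seq big1 // => p ps.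
rewrite rmorphM lift2l lift2r.
by have [/fJ->|/gJ->] := sP _ ps; rewrite ?mul0r ?mulr0.
Qed.

End Convolution.

(** * Subgroups with the same kernel and the same image *)
Section QuotientHopf.
Variables (k : comPzRingType).

Definition hopf_morphism (A B : hopf_algebra k) (f : alg_hom A B) : Prop :=
  [/\ forall x, comul B (f x) = map2 f f (comul A x),
      forall x, counit B (f x) = counit A x
    & forall x, antipode B (f x) = f (antipode A x)].

(** The same map, seen as linear along the identity of k: the transport lemmas for
Hopf algebra structures are stated for semilinear maps. *)
Definition restr_id (A B : algebra k) (f : alg_hom A B) :
    alg_hom A (restr_scalars (idfun : {rmorphism k -> k}) B) :=
  @AlgHom k A (restr_scalars (idfun : {rmorphism k -> k}) B) f (hom_alg f).

Lemma semi_map2_id (A B : algebra k) (f : alg_hom A B) x :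
  semi_map2 (restr_id f) (restr_id f) x = map2 f f x.
Proof.
pose g := semi_map2 (restr_id f) (restr_id f).
have gE c : g (alg_map _ c) = alg_map (tens2 B B) c by rewrite hom_alg.
apply: (ext2 (g := @AlgHom k (tens2 A A) (tens2 B B) (hom_fun g) gE)
  (h := map2 f f)) => b.
  by rewrite map2l [LHS]semi_map2l.
by rewrite map2r [LHS]semi_map2r.
Qed.

Lemma tens_ideal_map2 (A B : algebra k) (J : set A) (f : alg_hom A B) z :
  (forall x, J x -> f x = 0) -> tens_ideal J z -> map2 f f z = 0.
Proof.
move=> fJ [s sP ->]; rewrite rmorph_sum big_seq big1 // => p /sP ps.
rewrite rmorphM map2l map2r.
by case: ps => /fJ ->; rewrite rmorph0 ?mul0r ?mulr0.
Qed.

Lemma quotient_hopf (P : hopf_algebra k) (J : set P) : hopf_ideal J ->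
  exists (Q : hopf_algebra k) (p : alg_hom P Q),
  [/\ hopf_morphism p, forall u, exists x, u = p x & forall x, p x = 0 <-> J x].
Proof.
move=> [iJ JC Je JS]; have [Q [p [pS pJ]]] := quotient_algebra iJ.
have [cm cmE] := @factor_surjection k P Q (tens2 Q Q) p
  (comp_hom (map2 p p) (comul P)) pS
  (fun x px => tens_ideal_map2 (fun y => (pJ y).2) (JC x ((pJ x).1 px))).
have [cu cuE] := @factor_surjection k P Q (base_algebra k) p (counit P) pS
  (fun x px => Je x ((pJ x).1 px)).
have [an anE] := @factor_surjection k P Q Q p (comp_hom p (antipode P)) pS
  (fun x px => (pJ _).2 (JS x ((pJ x).1 px))).
pose u := restr_id p.
have cmE' a : cm (u a) = semi_map2 u u (comul P a).
  by rewrite semi_map2_id [LHS]cmE.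
have C1 a : tens_assoc _ _ _ (map2 cm (id_hom Q) (cm a)) =
    map2 (id_hom Q) cm (cm a).
  by have [x ->] := pS a; exact: (transport_coassoc cmE').
have C2 a : lift2 (comp_hom (unit_hom Q) cu) (id_hom Q) (cm a) = a.
  by have [x ->] := pS a; exact: (transport_counitl cmE' cuE).
have C3 a : lift2 (id_hom Q) (comp_hom (unit_hom Q) cu) (cm a) = a.
  by have [x ->] := pS a; exact: (transport_counitr cmE' cuE).
have C4 a : lift2 an (id_hom Q) (cm a) = unit_hom Q (cu a).
  by have [x ->] := pS a; exact: (transport_antipodel cmE' cuE anE).
have C5 a : lift2 (id_hom Q) an (cm a) = unit_hom Q (cu a).
  by have [x ->] := pS a; exact: (transport_antipoder cmE' cuE anE).
by exists (HopfAlgebra C1 C2 C3 C4 C5), p.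
Qed.

End QuotientHopf.

Section KernelImage.
Variables (k : fieldType) (P B : hopf_algebra k) (phi : alg_hom B P).
Hypothesis phiH : hopf_morphism phi.
Variables (I0 I1 : set P).
Hypotheses (I0H : hopf_ideal I0) (I1H : hopf_ideal I1) (I01 : I0 `<=` I1).
Hypothesis same_image : forall b, I1 (phi b) -> I0 (phi b).
Hypothesis same_kernel :
  I1 `<=` ideal_gen (I0 `|` phi @` [set b | counit B b = 0]).

(** The point g^-1 g' of G0 maps to the identity under phi, so it lies in the
kernel; as G1 has the same kernel, it lies in G1, and g' = g (g^-1 g') does
too. *)
Lemma kernel_points (R : algebra k) (g g' : alg_hom P R) :
  kills I1 g -> kills I0 g' -> (forall b, g (phi b) = g' (phi b)) ->
  kills I1 g'.
Proof.
move=> gI g'I gphi; pose m := conv (comp_hom g (antipode P)) g'.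
have mI1 : kills I1 m.
  move=> x /same_kernel; move: x.
  apply: (@ideal_gen_min _ _ [set x | m x = 0]).
    by apply: (@ideal_preimage _ _ m [set 0]); split=> // [x y -> ->|a x ->];
      rewrite ?addr0 ?mulr0.
  move=> x [I0x|[b /= b0 <-]]; rewrite /mkset.
    have [_ I0C _ I0S] := I0H.
    have gSI : kills I0 (comp_hom g (antipode P)).
      by move=> y /I0S/I01 Iy; exact: gI.
    exact: (kills_conv I0C gSI g'I I0x).
  have [phiC phie phiS] := phiH.
  rewrite phiC lift2_comp (@eq_lift2 _ _ _ _ _
    (comp_hom (comp_hom g phi) (antipode B)) _
    (comp_hom (comp_hom g phi) (id_hom B))).
  - have := comp_lift2 (antipode B) (id_hom B) (comp_hom g phi) (comul B b).
    by rewrite hopf_antipodel b0 !rmorph0 => <-.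
  - by move=> y /=; rewrite phiS.
  - by move=> y /=; rewrite gphi.
have [_ I1C _ _] := I1H.
move=> x I1x; rewrite -(conv1f g') -[LHS](eq_conv (convfV g) (frefl g')).
by rewrite -convA; apply: (kills_conv I1C gI mI1).
Qed.

(** Apply [kernel_points] to the tautological points over the tensor product R of
C' and C over D. An x in I1 then vanishes in R, which is a finite identity in
C' (x) C. A linear map L from C' to C that sends 1 to 1 and is D-linear on the
finitely many elements involved turns it into p x = 0. *)
Lemma kernel_image : I1 `<=` I0.
Proof.
have [C' [p' [p'H p'S p'I]]] := quotient_hopf I1H.
have [C [p [pS pI]]] := quotient_algebra (let: And4 iI _ _ _ := I0H in iI).
have [phiC phie phiS] := phiH; have [p'C p'e p'S'] := p'H.
pose T := tens2 C' C.
pose gens := [set z : T | exists b,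
  z = tens_inl C' C (p' (phi b)) - tens_inr C' C (p (phi b))].
have [R [rho [_ rhoI]]] := @quotient_algebra k T _ (ideal_gen_ideal gens).
move=> x I1x.
have rx : ideal_gen gens (tens_inr C' C (p x)).
  apply/rhoI; pose g := comp_hom rho (comp_hom (tens_inl C' C) p').
  pose g' := comp_hom rho (comp_hom (tens_inr C' C) p).
  apply: (@kernel_points R g g' _ _ _ x I1x) => [y /p'I|y /pI|b] /=.
  - by move=> ->; rewrite !rmorph0.
  - by move=> ->; rewrite !rmorph0.
  - apply/subr0_eq; rewrite -rmorphB; apply/rhoI; apply: ideal_gen_sub.
    by exists b.
(* Q z: the class of z in the tensor product over D is killed by every map q (x) c
   |-> L q * c, as soon as L is D-linear at finitely many places ps. *)
pose Q (z : T) := exists ps : seq C', forall L : C' -> C, lin L ->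
  (forall q b, q \in ps -> L (p' (phi b) * q) = p (phi b) * L q) ->
  forall f : T -> C, zmod_morphism f ->
  (forall q c, f (tens_pure q c) = L q * c) -> f z = 0.
have [ps psP] : Q (1 * tens_inr C' C (p x)).
  move: (1 : T); apply: (rx [set z : T | forall w, Q (w * z)]); split=> /=.
    split=> /= [w|y z Qy Qz w|y z Qz w].
    - exists [::] => L _ _ f fB _; rewrite mulr0.
      by rewrite -(subrr 0) fB subrr.
    - have [s sP] := Qy w; have [s' s'P] := Qz w.
      exists (s ++ s') => L Ll LD f fB fE; rewrite mulrDr.
      rewrite -[w * z]opprK fB -[- (w * z)]sub0r fB.
      have f0 : f 0 = 0 by rewrite -(subrr 0) fB subrr.
      rewrite f0 (sP L) // ?(s'P L) ?subr0 // => q b qs; apply: LD.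
        by rewrite mem_cat qs orbT.
      by rewrite mem_cat qs.
    - by rewrite mulrA; exact: Qz.
  move=> _ [b ->] w; have [s ->] := tens2_span w.
  exists [seq q.1 | q <- s] => L Ll LD f fB fE.
  rewrite mulr_suml zmod_morphism_sum // big_seq big1 // => q qs.
  have -> : tens_pure q.1 q.2 *
      (tens_inl C' C (p' (phi b)) - tens_inr C' C (p (phi b))) =
      tens_pure (p' (phi b) * q.1) q.2 - tens_pure q.1 (p (phi b) * q.2).
    rewrite mulrBr /tens_pure !rmorphM mulrA; congr (_ - _).
      by rewrite mulrC mulrA.
    exact: mulrAC.
  by rewrite fB !fE LD ?map_f // mulrA [p _ * _]mulrC subrr.
pose D := [set d : C' | exists b, d = p' (phi b)].
have [||||| W [W1 WD WM WF Wps]] := @hopf_subalgebra_retraction k C' D _ _ _ _ _ ps.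
- by move=> c; exists (alg_map B c); rewrite !hom_alg.
- by move=> _ _ [b ->] [b' ->]; exists (b + b'); rewrite !rmorphD.
- by move=> _ _ [b ->] [b' ->]; exists (b * b'); rewrite !rmorphM.
- by move=> _ [b ->]; exists (antipode B b); rewrite p'S' phiS.
- move=> _ [b ->]; rewrite p'C phiC; have [s ->] := tens2_span (comul B b).
  rewrite !rmorph_sum; apply: tens_span_sum => q; rewrite !map2_pure.
  by apply: tens_span_pure; eexists.
(* D embeds in C' and, by same_image, in C: this turns the retraction of C' onto
   D into a partial linear map from C' to C. *)
have [|L Ll LG] := @linear_extension k C' C
    [set q : C' * C | exists b, W (q.1, p' (phi b)) /\ q.2 = p (phi b)].
  split=> /=.
  - exists 0; rewrite !rmorph0; split=> //.
    have := WM _ _ _ (_ : D 0) W1; rewrite !mul0r; apply.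
    by exists 0; rewrite !rmorph0.
  - move=> y z y' z' [b [Wb ->]] [b' [Wb' ->]].
    by exists (b + b'); rewrite !rmorphD; split=> //; exact: WD.
  - move=> c y z [b [Wb ->]]; exists (alg_map B c * b).
    rewrite !rmorphM !hom_alg; split=> //; apply: WM => //.
    by exists (alg_map B c); rewrite !hom_alg.
  - move=> z [b [Wb ->]]; apply/pI/same_image/p'I.
    exact: (WF _ _ Wb).2.
have L1 : L 1 = 1.
  by apply: LG; exists 1; rewrite !rmorph1.
have [f fB fE] : exists2 f : T -> C, zmod_morphism f &
    forall q c, f (tens_pure q c) = L q * c.
  apply: tens2_balanced; split=> [y y' z|y z z'|c y z].
  - by rewrite Ll.1 mulrDl.
  - by rewrite mulrDr.
  - by rewrite Ll.2 mulrCA mulrA.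
apply/pI; rewrite -[p x]mul1r -L1 -fE -tens_pure1 -[tens_inr _ _ _]mul1r.
apply: psP Ll _ f fB fE => q b /Wps[y Wqy].
have [[b0 yE] _] := WF _ _ Wqy.
rewrite (LG (p' (phi b) * q) (p (phi (b * b0)))); last first.
  exists (b * b0); split=> //; rewrite !rmorphM -yE; apply: WM => //.
  by exists b.
rewrite (LG q (p (phi b0))); last by exists b0; rewrite -yE.
by rewrite !rmorphM.
Qed.

End KernelImage.

(** * Hopf ideals and the coordinate rings of the products *)
Section HopfIdeals.
Variables (k : comPzRingType) (P : hopf_algebra k).
Implicit Types (J S : set P).

Lemma tens_ideal_ideal J : is_ideal J -> is_ideal (tens_ideal J).
Proof.
move=> [J0 JD JM]; split=> [|x y [s sP ->] [s' s'P ->]|w _ [s sP ->]].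
- by exists [::]; rewrite ?big_nil.
- exists (s ++ s'); last by rewrite big_cat.
  by move=> p; rewrite mem_cat => /orP[/sP|/s'P].
- have [r ->] := tens2_span w.
  exists [seq (q.1 * p.1, q.2 * p.2) | q <- r, p <- s].
    by move=> _ /allpairsP[[q p] /= [_ /sP[] Jp ->]]; [left|right]; exact: JM.
  rewrite big_allpairs_dep mulr_suml; apply: eq_bigr => q _.
  by rewrite mulr_sumr; apply: eq_bigr => p _; rewrite tens_pureM.
Qed.

Lemma tens_ideal_sub J J' z : J `<=` J' -> tens_ideal J z -> tens_ideal J' z.
Proof.
by move=> JJ [s sP ->]; exists s => // p /sP[/JJ ?|/JJ ?]; [left|right].
Qed.

(** The conditions to check on generators of an ideal for it to be a Hopf ideal
([hopf_ideal_gen]); J is a parameter since the generated ideal is larger than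
the set of generators. *)
Definition hopf_stable J : set P :=
  [set x | [/\ tens_ideal J (comul P x), counit P x = 0 & J (antipode P x)]].

Lemma hopf_ideal_gen S : S `<=` hopf_stable (ideal_gen S) ->
  hopf_ideal (ideal_gen S).
Proof.
move=> SP; have iJ := ideal_gen_ideal S; split=> //.
- apply: ideal_gen_min => [|x /SP[]//].
  exact: ideal_preimage (tens_ideal_ideal iJ).
- apply: ideal_gen_min => [|x /SP[]//].
  split=> [|x y /= x0 y0|a x /= x0]; first exact: rmorph0.
    by rewrite rmorphD /= x0 y0 addr0.
  by rewrite rmorphM /= x0 mulr0.
- apply: ideal_gen_min => [|x /SP[]//].
  exact: ideal_preimage iJ.
Qed.

Lemma hopf_stable_sub J J' : J `<=` J' -> hopf_stable J `<=` hopf_stable J'.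
Proof.
by move=> JJ x [xC xe /JJ xS]; split=> //; exact: tens_ideal_sub xC.
Qed.

Lemma hopf_ideal_stable J : hopf_ideal J -> J `<=` hopf_stable J.
Proof. by move=> [_ JC Je JS] x Jx; split; [exact: JC|exact: Je|exact: JS]. Qed.

Lemma counit_sub_counit x : counit P (x - alg_map P (counit P x)) = 0.
Proof. by rewrite rmorphB hom_alg /= subrr. Qed.

(** For x of counit 0, comul x = sum (x_1 - counit x_1) (x) x_2 + 1 (x) x. *)
Lemma augmentation_hopf_ideal : hopf_ideal [set x | counit P x = 0].
Proof.
split=> [|x /= x0|//|x /= x0].
- split=> [|x y /= x0 y0|a x /= x0]; first exact: rmorph0.
    by rewrite rmorphD /= x0 y0 addr0.
  by rewrite rmorphM /= x0 mulr0.
- have [s sE] := tens2_span (comul P x).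
  have xE : x = \sum_(p <- s) unit_hom P (counit P p.1) * p.2.
    rewrite -[LHS](hopf_counitl x) sE rmorph_sum.
    by apply: eq_bigr => p _; rewrite rmorphM lift2l lift2r.
  exists (rcons [seq (p.1 - unit_hom P (counit P p.1), p.2) | p <- s] (1, x)).
    move=> p; rewrite mem_rcons inE => /predU1P[->|/mapP[q _ ->]] /=.
      by right.
    by left; exact: counit_sub_counit.
  rewrite -cats1 big_cat big_seq1 /= big_map.
  rewrite sE [X in tens_pure 1 X]xE tens_pure_sumr -big_split.
  apply: eq_bigr => p _ /=.
  by rewrite [alg_map _ _ * _]mulrC mulrC tens_pure_scale mulr1 -tens_pureDl subrK.
- have [s sE] := tens2_span (comul P x).
  rewrite /= -(hopf_counitr x) sE.
  have := congr1 (counit P) (hopf_antipodel x).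
  rewrite [in RHS]/= hom_alg /= x0 sE => <-; rewrite !rmorph_sum.
  by apply: eq_bigr => p _; rewrite !rmorphM !lift2l !lift2r /= !hom_alg.
Qed.

End HopfIdeals.

Section SemilinearHopf.
Variables (k k' : comPzRingType) (t : {rmorphism k -> k'}).
Variables (A : hopf_algebra k) (A' : hopf_algebra k').

Definition semi_hopf_morphism (f : alg_hom A (restr_scalars t A')) : Prop :=
  [/\ forall x, comul A' (f x) = semi_map2 f f (comul A x),
      forall x, counit A' (f x) = t (counit A x)
    & forall x, antipode A' (f x) = f (antipode A x)].

Lemma semi_hopf_stable f (J : set A) (J' : set A') :
  semi_hopf_morphism f -> hopf_ideal J -> f @` J `<=` J' ->
  f @` J `<=` hopf_stable J'.
Proof.
move=> [fC fe fS] [_ JC Je JS] JJ' _ [x Jx <-]; split.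
- rewrite fC; have [s sP ->] := JC x Jx; exists [seq (f p.1, f p.2) | p <- s].
    move=> _ /mapP[p /sP ps ->] /=.
    by case: ps => Jp; [left; apply: JJ'; exists p.1|right; apply: JJ'; exists p.2].
  rewrite rmorph_sum big_map; apply: eq_bigr => p _.
  by rewrite rmorphM semi_map2l semi_map2r.
- by rewrite fe Je // rmorph0.
- by rewrite fS; apply: JJ'; exists (antipode A x) => //; exact: JS.
Qed.

End SemilinearHopf.

Lemma hopf_morphism_semi (k : comPzRingType) (A A' : hopf_algebra k)
  (f : alg_hom A A') : hopf_morphism f -> semi_hopf_morphism (restr_id f).
Proof. by move=> [fC fe fS]; split=> // x; rewrite semi_map2_id; exact: fC. Qed.

Lemma hopf_morphism_stable (k : comPzRingType) (A A' : hopf_algebra k)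
    (f : alg_hom A A') (J : set A) (J' : set A') :
  hopf_morphism f -> hopf_ideal J -> f @` J `<=` J' ->
  f @` J `<=` hopf_stable J'.
Proof. by move=> /hopf_morphism_semi; exact: semi_hopf_stable. Qed.

Section TensorHopfMorphism.
Variables (k : comPzRingType) (T : Type) (A : T -> hopf_algebra k).

Lemma tens_in_hopf i : hopf_morphism
  (tens_in A i : alg_hom (A i) (hopf_tensor A)).
Proof. by split=> x; exact: tens_lift_in. Qed.

Lemma tens_lift_hopf (B : hopf_algebra k) (f : forall i, alg_hom (A i) B) :
  (forall i, hopf_morphism (f i)) ->
  hopf_morphism (tens_lift f : alg_hom (hopf_tensor A) B).
Proof.
move=> fH; pose g : alg_hom (hopf_tensor A) B := tens_lift f.
have gE i a : g (tens_in A i a) = f i a := tens_lift_in f a.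
split=> x.
- apply: (tens_ext (g := comp_hom (comul B) g)
    (h := comp_hom (map2 g g) (comul (hopf_tensor A)))) x => i a.
  have [fC _ _] := fH i; have [iC _ _] := tens_in_hopf i.
  rewrite /= [X in comul B X](gE i a) fC iC.
  have [s ->] := tens2_span (comul (A i) a).
  rewrite !rmorph_sum; apply: eq_bigr => p _.
  by rewrite !rmorphM !map2l !map2r !gE.
- apply: (tens_ext (g := comp_hom (counit B) g)
    (h := counit (hopf_tensor A))) x => i a.
  have [_ fe _] := fH i; have [_ ie _] := tens_in_hopf i.
  by rewrite /= [X in counit B X](gE i a) fe [RHS]ie.
- apply: (tens_ext (g := comp_hom (antipode B) g)
    (h := comp_hom g (antipode (hopf_tensor A)))) x => i a.
  have [_ _ fS] := fH i; have [_ _ iS] := tens_in_hopf i.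
  by rewrite /= [X in antipode B X](gE i a) fS iS [RHS]gE.
Qed.

End TensorHopfMorphism.

Section CoordMorphisms.
Variables (n : nat) (k : sigma_field n) (G : algebraic_group k).

Lemma coord_factor_hopf i (t : 'X_{1..n < i.+1}) :
  @hopf_morphism k (hopf_base_change (sigma_act t) G) (coord_upto G i)
    (coord_factor G t).
Proof.
exact: (tens_in_hopf
  (fun t : 'X_{1..n < i.+1} => hopf_base_change (sigma_act t) G)).
Qed.

Lemma coord_incl_hopf i : hopf_morphism (coord_incl G i).
Proof. by apply: tens_lift_hopf => t; exact: coord_factor_hopf (widen_mon t). Qed.

Lemma coord_incl_factor i (t : 'X_{1..n < i.+1}) b :
  coord_incl G i (coord_factor G t b) = coord_factor G (widen_mon t) b.
Proof. exact: tens_lift_in. Qed.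

Lemma coord_sigma_factor i j (t : 'X_{1..n < i.+1}) (a : G) :
  coord_sigma G i j (coord_factor G t (bc_in (sigma_act t) G a)) =
  coord_factor G (shift_mon j t) (bc_in (sigma_act (shift_mon j t)) G a).
Proof. by rewrite [LHS]tens_lift_in [LHS]bc_lift_in. Qed.

(** All maps involved are determined by the elements a (x) 1 of the factors, where
sigma_j only relabels the factor. *)
Lemma coord_sigma_hopf i j : semi_hopf_morphism (coord_sigma G i j).
Proof.
set S := coord_sigma G i j; split=> x.
- pose C := restr_scalars (sigma k j)
    (tens2 (coord_upto G i.+1) (coord_upto G i.+1)).
  pose u : alg_hom (coord_upto G i) C := comp_hom (restr_hom (sigma k j)
    (comul (coord_upto G i.+1))) S.
  pose v : alg_hom (coord_upto G i) C :=
    comp_hom (semi_map2 S S) (comul (coord_upto G i)).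
  apply: (tens_ext (g := u) (h := v)) x => t b.
  apply: (bc_ext (g := comp_hom u (coord_factor G t))
    (h := comp_hom v (coord_factor G t))) b => a.
  have [c1 _ _] := coord_factor_hopf t.
  have [c2 _ _] := coord_factor_hopf (shift_mon j t).
  transitivity (comul (coord_upto G i.+1)
    (S (coord_factor G t (bc_in (sigma_act t) G a)))) => //.
  rewrite coord_sigma_factor c2 [RHS]/= c1 /= !bc_comulE.
  have [s ->] := tens2_span (comul G a).
  rewrite !rmorph_sum; apply: eq_bigr => p _.
  rewrite !rmorphM !semi_map2l !semi_map2r !map2l !map2r.
  by rewrite !semi_map2l !semi_map2r !coord_sigma_factor.
- pose C := restr_scalars (sigma k j) (base_algebra k).
  pose u : alg_hom (coord_upto G i) C := comp_hom (restr_hom (sigma k j)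
    (counit (coord_upto G i.+1))) S.
  pose v : alg_hom (coord_upto G i) C :=
    comp_hom (unit_hom C) (counit (coord_upto G i)).
  apply: (tens_ext (g := u) (h := v)) x => t b.
  apply: (bc_ext (g := comp_hom u (coord_factor G t))
    (h := comp_hom v (coord_factor G t))) b => a.
  have [_ c1 _] := coord_factor_hopf t.
  have [_ c2 _] := coord_factor_hopf (shift_mon j t).
  transitivity (counit (coord_upto G i.+1)
    (S (coord_factor G t (bc_in (sigma_act t) G a)))) => //.
  rewrite coord_sigma_factor c2 [RHS]/= c1 /= !bc_counitE /=.
  by rewrite sigma_actD sigma_act1.
- pose C := restr_scalars (sigma k j) (coord_upto G i.+1).
  pose u : alg_hom (coord_upto G i) C := comp_hom (restr_hom (sigma k j)
    (antipode (coord_upto G i.+1))) S.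
  pose v : alg_hom (coord_upto G i) C := comp_hom S (antipode (coord_upto G i)).
  apply: (tens_ext (g := u) (h := v)) x => t b.
  apply: (bc_ext (g := comp_hom u (coord_factor G t))
    (h := comp_hom v (coord_factor G t))) b => a.
  have [_ _ c1] := coord_factor_hopf t.
  have [_ _ c2] := coord_factor_hopf (shift_mon j t).
  transitivity (antipode (coord_upto G i.+1)
    (S (coord_factor G t (bc_in (sigma_act t) G a)))) => //.
  rewrite coord_sigma_factor c2 [RHS]/= c1 /= !bc_antipodeE /=.
  by rewrite [RHS]coord_sigma_factor.
Qed.

End CoordMorphisms.

(** * Comparing subgroups of the product fibre by fibre *)
Section Filtration.
Variables (n : nat) (k : sigma_field n) (G : algebraic_group k) (i : nat).
Let P := coord_upto G i.
Implicit Types (S : set 'X_{1..n < i.+1}) (J : set P).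

Definition factor_augmentations S : set P :=
  \bigcup_(t in S) (coord_factor G t @`
    [set b | counit (hopf_base_change (sigma_act t) G) b = 0]).

(** The ideal of the subgroup of those points of the subgroup defined by J whose
coordinates in S are trivial. *)
Definition fiber_ideal J S : set P := ideal_gen (J `|` factor_augmentations S).

Definition below (t : 'X_{1..n < i.+1}) : set 'X_{1..n < i.+1} :=
  [set s | ((s : 'X_{1..n}) < t)%O].

Lemma fiber_ideal_hopf J S : hopf_ideal J -> hopf_ideal (fiber_ideal J S).
Proof.
move=> JH; apply: hopf_ideal_gen => x [/(hopf_ideal_stable JH)|[t St xt]].
  apply: hopf_stable_sub => y Jy.
  by apply: ideal_gen_sub; left.
apply: (hopf_morphism_stable (coord_factor_hopf G t)
  (@augmentation_hopf_ideal _ _)) xt => y yt.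
by apply: ideal_gen_sub; right; exists t.
Qed.

Lemma sub_fiber_ideal J S : J `<=` fiber_ideal J S.
Proof. by move=> x Jx; apply: ideal_gen_sub; left. Qed.

Lemma fiber_ideal_mono J J' S S' : J `<=` J' -> S `<=` S' ->
  fiber_ideal J S `<=` fiber_ideal J' S'.
Proof.
move=> JJ SS; apply: ideal_gen_min => [|x]; first exact: ideal_gen_ideal.
case=> [Jx|[t St xt]]; apply: ideal_gen_sub; first by left; exact: JJ.
by right; exists t => //; exact: SS.
Qed.

(** A point all of whose coordinates are trivial is the identity. *)
Lemma augmentation_generated x : counit P x = 0 ->
  fiber_ideal set0 setT x.
Proof.
have iF := ideal_gen_ideal (set0 `|` factor_augmentations setT).
suff main y : fiber_ideal set0 setT (y - alg_map P (counit P y)).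
  by move=> x0; have := main x; rewrite x0 rmorph0 subr0.
have [F0 FD FM] := iF.
move: y; elim/tens_ring_ind=> [c|t a|y z Fx Fy|y Fx|y z Fx Fy].
- by rewrite hom_alg subrr.
- apply: ideal_gen_sub; right; exists t => //.
  pose b : hopf_base_change (sigma_act t) G := a.
  have [_ ce _] := coord_factor_hopf G t.
  exists (b - alg_map _ (counit _ b)).
    exact: counit_sub_counit.
  rewrite [LHS]rmorphB; congr (_ - _); rewrite [LHS](hom_alg (coord_factor G t)).
  by congr (alg_map _ _); exact/esym/ce.
- by rewrite !rmorphD opprD addrACA; exact: FD.
- by rewrite !rmorphN -opprD; exact: (idealN iF).
- rewrite !rmorphM; set e := alg_map P _; set e' := alg_map P _.
  have -> : y * z - e * e' = z * (y - e) + e * (z - e').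
    by rewrite !mulrBr [z * y]mulrC [z * e]mulrC addrA subrK.
  by apply: FD; exact: FM.
Qed.

(** Downward induction over initial segments S, from all monomials, where both
subgroups become trivial, to the empty set. The complement of S has a least
element t, so S is [below t]; imposing triviality at t as well is passing to the
kernel of the projection to the factor t, and fib compares the images. *)
Lemma fiberwise_inclusion J0 J1 : hopf_ideal J0 -> hopf_ideal J1 ->
  J0 `<=` J1 ->
  (forall t b, fiber_ideal J1 (below t) (coord_factor G t b) ->
     fiber_ideal J0 (below t) (coord_factor G t b)) ->
  J1 `<=` J0.
Proof.
move=> J0H J1H J01 fib.
suff main m S : (forall t s, S t -> below t s -> S s) ->
    (#|[pred t | ~~ `[< S t >]]| <= m)%N -> J1 `<=` fiber_ideal J0 S.
  have H : J1 `<=` fiber_ideal J0 set0 by apply: main (leqnn _).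
  move=> x /H; apply: ideal_gen_min => [|y [//|[]//]]; by case: J0H.
elim: m S => [|m IH] S Sdown.
  rewrite leqn0 => /eqP/card0_eq S0.
  move=> x J1x; have [_ _ Je _] := J1H.
  have := augmentation_generated (Je x J1x); apply: fiber_ideal_mono => // t _.
  by have := S0 t; rewrite inE => /negbFE/asboolP.
have [allS _|nall] := pselect (forall t, S t).
  apply: IH => //; rewrite eq_card0 // => t.
  by rewrite !inE; apply/negbTE; rewrite negbK; apply/asboolP.
have [t nSt tmin] : exists2 t, ~ S t & forall s, below t s -> S s.
  apply: contrapT => nt; apply: nall => t; apply: contrapT => nSt; apply: nt.
  move: {2}(t : 'X_{1..n}) (erefl (t : 'X_{1..n})) nSt => u.
  elim/(@ltmwf n): u t => u IHu t tu nSt.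
  have [[r nSr rt]|nr] := pselect (exists2 r, ~ S r & below t r).
    by apply: IHu nSr; [rewrite -tu; exact: rt|].
  by exists t => // r rt; apply: contrapT => nSr; apply: nr; exists r.
have SE : S = below t.
  apply/seteqP; split=> s; last exact: tmin.
  move=> Ss; rewrite /below /= Order.TotalTheory.ltNge; apply/negP.
  rewrite Order.POrderTheory.le_eqVlt => /orP[/eqP/val_inj ts|st].
    by apply: nSt; rewrite ts.
  by apply: nSt; apply: Sdown Ss st.
move=> cardS; rewrite SE.
pose S' := S `|` [set t].
have J1S' : J1 `<=` fiber_ideal J0 S'.
  apply: IH => [s r [Ss|->] rs|].
  - by left; exact: Sdown Ss rs.
  - by left; exact: tmin.
  rewrite -ltnS (leq_trans _ cardS) // (cardD1 t [pred s | ~~ `[< S s >]]).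
  rewrite inE; case: asboolP => // _; rewrite ltnS; apply: subset_leq_card.
  apply/fintype.subsetP => s; rewrite !inE => /asboolP nS's.
  apply/andP; split; first by apply/eqP=> st; apply: nS's; right.
  by apply/asboolP => Ss; apply: nS's; left.
have sub : fiber_ideal J1 (below t) `<=` fiber_ideal J0 (below t).
  apply: (kernel_image (coord_factor_hopf G t)); try exact: fiber_ideal_hopf.
  - exact: fiber_ideal_mono.
  - exact: fib.
  apply: ideal_gen_min => [|x]; first exact: ideal_gen_ideal.
  have sS' : fiber_ideal J0 S' `<=` ideal_gen (fiber_ideal J0 (below t) `|`
      coord_factor G t @` [set b | counit (hopf_base_change (sigma_act t) G) b = 0]).
    apply: ideal_gen_min => [|y]; first exact: ideal_gen_ideal.
    case=> [J0y|[s]]; first by apply: ideal_gen_sub; left; exact: sub_fiber_ideal.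
    rewrite /S' SE => -[st|->] ys; apply: ideal_gen_sub; last by right.
    by left; apply: ideal_gen_sub; right; exists s.
  case=> [/J1S'/sS'//|xt]; apply: sS'; apply: ideal_gen_sub; right.
  by case: xt => s st xs; exists s => //; rewrite /S' SE; left.
by move=> x /(@sub_fiber_ideal _ (below t))/sub.
Qed.

End Filtration.

(** * A Noetherian property over the monoid of monomials *)
Section Dickson.

(** Pick the position of a minimum of u, then of a minimum of u beyond it, and so
on. *)
Lemma monotone_subsequence (u : nat -> nat) : exists g : nat -> nat,
  (forall i, g i < g i.+1)%N /\ (forall i, u (g i) <= u (g i.+1))%N.
Proof.
have minP s : exists i, (s <= i)%N /\ forall j, (s <= j)%N -> (u i <= u j)%N.
  pose p v := `[< exists2 i, (s <= i)%N & u i = v >].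
  have ep : exists v, p v by exists (u s); apply/asboolP; exists s.
  case: (ex_minnP ep) => v /asboolP[i si ui] vmin; exists i; split=> // j sj.
  by rewrite ui; apply: vmin; apply/asboolP; exists j.
have [next nextP] := choice minP.
pose g := fix g i := if i is j.+1 then next (g j).+1 else next 0%N.
exists g; split=> i /=; first by case: (nextP (g i).+1).
have [s [sg gmin]] : exists s, (s <= g i)%N /\
    forall j, (s <= j)%N -> (u (g i) <= u j)%N.
  by case: i => [|i] /=; eexists; exact: nextP.
by apply/gmin/(leq_trans sg)/ltnW; case: (nextP (g i).+1).
Qed.

Lemma monotone_sequence (u : nat -> nat) : (forall i, u i <= u i.+1)%N ->
  forall i j, (i <= j)%N -> (u i <= u j)%N.
Proof.
move=> uS i j /subnK <-; elim: (j - i)%N => // d IH.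
by rewrite addSn; exact: leq_trans IH (uS _).
Qed.

Lemma dickson (T : finType) (u : T -> nat -> nat) : exists g : nat -> nat,
  (forall i, g i < g i.+1)%N /\
  (forall r i j, (i <= j)%N -> (u r (g i) <= u r (g j))%N).
Proof.
suff [g [gS gu]] : exists g : nat -> nat, (forall i, g i < g i.+1)%N /\
    (forall r, r \in enum T -> forall i, (u r (g i) <= u r (g i.+1))%N).
  exists g; split=> // r.
  by apply: (@monotone_sequence (u r \o g)); apply: gu; rewrite mem_enum.
elim: (enum T) => [|r s [g [gS gu]]]; first by exists id; split=> // i.
have [h [hS hu]] := monotone_subsequence (u r \o g).
have gm := @monotone_sequence g (fun i => ltnW (gS i)).
exists (g \o h); split=> [i|q] /=.
  exact: leq_trans (gS _) (gm _ _ (hS i)).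
rewrite inE => /predU1P[->|qs] i; first exact: hu.
apply: (@monotone_sequence (u q \o g)); last exact: ltnW.
exact: gu.
Qed.

End Dickson.

Section NoetherianFamily.
Variables (n m : nat) (k : sigma_field n).
Variable (A : nat -> 'X_{1..n} -> set {mpoly k[m]}).
Hypothesis AD : forall i t p q, A i t p -> A i t q -> A i t (p + q).
Hypothesis AM : forall i t p q, A i t q -> A i t (p * q).
Hypothesis Adeg : forall i t p, A i t p -> (mdeg t <= i)%N.
Hypothesis Aincl : forall i t p, A i t p -> A i.+1 t p.
Hypothesis Asigma : forall i t j p,
  A i t p -> A i.+1 (U_(j) + t)%MM (map_mpoly (sigma k j) p).

Definition leading (i : nat) (t : 'X_{1..n}) (e : 'X_{1..m}) : Prop :=
  exists p, [/\ A i t p, p != 0 & mlead p = e].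

Lemma leading_up i t e e' : leading i t e -> leading i t (e + e')%MM.
Proof.
have X0 : 'X_[e'] != 0 :> {mpoly k[m]} by rewrite -msupp_eq0 msuppX.
move=> [p [Ap p0 pe]]; exists ('X_[e'] * p); split; first exact: AM.
  by rewrite mulf_neq0.
by rewrite mleadM // mleadXm pe addmC.
Qed.

Lemma map_mpoly_sigma_neq0 j (p : {mpoly k[m]}) : p != 0 ->
  map_mpoly (sigma k j) p != 0.
Proof.
apply: contraNneq => p0; apply/eqP/mpolyP => e; rewrite mcoeff0.
have := congr1 (mcoeff e) p0; rewrite mcoeff_map_mpoly mcoeff0 => /eqP.
by rewrite fmorph_eq0 => /eqP.
Qed.

Lemma mlead_map_sigma j (p : {mpoly k[m]}) :
  mlead (map_mpoly (sigma k j) p) = mlead p.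
Proof.
have supp e : (e \in msupp (map_mpoly (sigma k j) p)) = (e \in msupp p).
  by rewrite !mcoeff_msupp mcoeff_map_mpoly fmorph_eq0.
have [->|p0] := eqVneq p 0.
  by congr mlead; apply/mpolyP => e; rewrite mcoeff_map_mpoly !mcoeff0 raddf0.
apply/Order.POrderTheory.le_anti/andP; split; apply: msupp_le_mlead.
  by rewrite -supp mlead_supp // map_mpoly_sigma_neq0.
by rewrite supp mlead_supp.
Qed.

Lemma leading_incl i t e : leading i t e -> leading i.+1 t e.
Proof. by move=> [p [Ap p0 pe]]; exists p; split=> //; exact: Aincl. Qed.

Lemma leading_sigma i t j e :
  leading i t e -> leading i.+1 (U_(j) + t)%MM e.
Proof.
move=> [p [Ap p0 pe]]; exists (map_mpoly (sigma k j) p); split.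
- exact: Asigma.
- exact: map_mpoly_sigma_neq0.
- by rewrite mlead_map_sigma.
Qed.

Lemma mnm_split (d : 'X_{1..n}) : d != 0%MM ->
  exists j c, d = (U_(j) + c)%MM /\ mdeg d = (mdeg c).+1.
Proof.
move=> d0; have [j dj] : exists j, d j != 0%N.
  apply: contrapT => nj; move/eqP: d0; apply; apply/mnmP => j; rewrite mnm0E.
  by apply/eqP; apply: contrapT => /negP dj; apply: nj; exists j.
have jd : (U_(j) <= d)%MM by rewrite lep1mP.
exists j, (d - U_(j))%MM; have dE : d = (U_(j) + (d - U_(j)))%MM.
  by rewrite addmC submK.
by split=> //; rewrite {1}dE mdegD mdeg1.
Qed.

Lemma leading_path i t e c d :
  leading i t e -> leading (c + mdeg d + i) (d + t)%MM e.
Proof.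
move=> ite; elim: c => [|c IH]; last by rewrite !addSn; exact: leading_incl.
rewrite add0n; have [s] := ubnP (mdeg d); elim: s d => // s IH d ds.
have [->|/mnm_split[j [d' [dE dd]]]] := eqVneq d 0%MM; first by rewrite mdeg0 add0m.
rewrite dd dE addSn -addmA; apply/leading_sigma/IH.
by rewrite -ltnS -dd.
Qed.

(** An exponent that appears at stage i + 1 without coming from stage i. *)
Definition new_leading i t e : Prop :=
  [/\ leading i.+1 t e, ~ leading i t e
    & forall j s, t = (U_(j) + s)%MM -> ~ leading i s e].

(** Otherwise Dickson's lemma gives new exponents at two stages, the slack
i + 1 - mdeg t, t and e all increasing from the first to the second. Slack grows
by inclusions and mdeg t by the sigma_j, so the first exponent propagates to the
stage after the second one by steps of these two kinds, and the last step
contradicts the newness of the second exponent. *)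
Lemma new_leading_bounded : exists N, forall i t e,
  (N <= i)%N -> ~ new_leading i t e.
Proof.
apply: contrapT => nN.
have /choice[f fP] N : exists w : nat * 'X_{1..n} * 'X_{1..m},
    (N <= w.1.1)%N /\ new_leading w.1.1 w.1.2 w.2.
  apply: contrapT => nw; apply: nN; exists N => i t e Ni new.
  by apply: nw; exists (i, t, e).
(* The subtraction does not truncate, as A i t is empty when mdeg t > i. *)
pose slack l := ((f l).1.1.+1 - mdeg (f l).1.2)%N.
pose u (r : option ('I_n + 'I_m)) l : nat := match r with
  | None => slack l
  | Some (inl j) => (f l).1.2 j
  | Some (inr j) => (f l).2 j
  end.
have [g [gS gu]] := dickson u.
have gid l : (l <= g l)%N.
  by elim: l => // l IH; exact: leq_ltn_trans IH (gS l).
set a := g 0%N; set b := g (f a).1.1.+1.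
have ab r : (u r a <= u r b)%N by exact: gu.
have ltab : ((f a).1.1 < (f b).1.1)%N.
  by apply: leq_trans (gid _) _; have [] := fP b.
have [_ [la _ _]] := fP a; have [_ [lb nb1 nb2]] := fP b.
have up t : leading t.1 t.2 (f a).2 -> leading t.1 t.2 (f b).2.
  have ea : ((f a).2 <= (f b).2)%MM by apply/mnm_lepP => j; exact: (ab (Some (inr j))).
  by move=> /(@leading_up _ _ _ ((f b).2 - (f a).2)%MM); rewrite addmC submK.
have [da db] : (mdeg (f a).1.2 <= (f a).1.1.+1)%N /\
    (mdeg (f b).1.2 <= (f b).1.1.+1)%N.
  by case: la lb => [p [/Adeg ? _ _]] [q [/Adeg ? _ _]].
have tE : (f b).1.2 = ((f b).1.2 - (f a).1.2 + (f a).1.2)%MM.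
  by rewrite submK //; apply/mnm_lepP => j; exact: (ab (Some (inl j))).
set d := ((f b).1.2 - (f a).1.2)%MM in tE.
have dE : mdeg (f b).1.2 = (mdeg d + mdeg (f a).1.2)%N by rewrite {1}tE mdegD.
have := ab None; rewrite /= /slack => slk.
have sd : (mdeg d + (f a).1.1 <= (f b).1.1)%N by lia.
have [lt_d|ge_d] := leqP (mdeg d + (f a).1.1.+1) (f b).1.1.
  apply: nb1; apply: (up ((f b).1.1, (f b).1.2)) => /=; rewrite tE.
  by rewrite -[X in leading X](subnK lt_d) addnA; exact: leading_path.
have d0 : d != 0%MM by rewrite -mdeg_eq0; lia.
have [j [c [dc dm]]] := mnm_split d0.
apply: (nb2 j (c + (f a).1.2)%MM); first by rewrite addmA -dc.
apply: (up ((f b).1.1, _)) => /=.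
have -> : (f b).1.1 = (0 + mdeg c + (f a).1.1.+1)%N by lia.
exact: leading_path.
Qed.

(** Division with remainder, by induction on the leading exponent of p: this
exponent is not new, so an element q of J coming from stage i has the same one,
and a multiple of q cancels the leading term of p. *)
Lemma noetherian_family : exists N, forall i t (J : set {mpoly k[m]}),
  (N <= i)%N -> is_ideal J -> A i t `<=` J ->
  (forall j s p, t = (U_(j) + s)%MM -> A i s p -> J (map_mpoly (sigma k j) p)) ->
  A i.+1 t `<=` J.
Proof.
have [N newN] := new_leading_bounded.
exists N => i t J Ni [J0 JD JM] AJ sJ p; elim/mleadrect: p => p IH Ap.
have [->//|p0] := eqVneq p 0.
have [q [Aq Jq q0 qp]] : exists q, [/\ A i.+1 t q, J q, q != 0 & mlead q = mlead p].
  have lp : leading i.+1 t (mlead p) by exists p.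
  apply: contrapT => nq; apply: (newN i t (mlead p) Ni); split=> //.
    move=> [q [Aq q0 qp]]; apply: nq; exists q; split=> //; first exact: Aincl.
    exact: AJ.
  move=> j s ts [q [Aq q0 qp]]; apply: nq; exists (map_mpoly (sigma k j) q).
  split.
  - by rewrite ts; exact: Asigma.
  - exact: sJ Aq.
  - exact: map_mpoly_sigma_neq0.
  - by rewrite mlead_map_sigma.
pose c := mleadc p / mleadc q.
have c0 : c != 0 by rewrite mulf_neq0 ?invr_eq0 ?mleadc_eq0.
pose r := p + (- c)%:MP * q.
have Ar : A i.+1 t r by apply: AD => //; exact: AM.
have Jp : J r -> J p.
  move=> Jr; have -> : p = r + c%:MP * q.
    by rewrite /r mpolyCN mulNr subrK.
  by apply: JD => //; exact: JM.
have [r0|r0] := eqVneq r 0; first by apply: Jp; rewrite r0.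
apply/Jp/IH => //; rewrite Order.POrderTheory.lt_neqAle; apply/andP; split.
  apply: contraNneq r0 => rp; rewrite -mleadc_eq0 rp.
  rewrite /r mcoeffD mul_mpolyC mcoeffZ -[in X in _ + X]qp /c.
  by rewrite mulNr mulfVK ?mleadc_eq0 ?subrr.
apply: Order.POrderTheory.le_trans (mleadD_le _ _) _.
by rewrite mul_mpolyC mleadZ ?oppr_eq0 // qp Order.JoinTheory.joinxx.
Qed.

End NoetherianFamily.

(** * Fibre ideals in polynomial coordinates *)
Section PolynomialEvaluation.
Variables (k : fieldType) (m : nat) (A : algebra k) (y : 'I_m -> A).

Definition peval (p : {mpoly k[m]}) : A :=
  \sum_(e <- msupp p) alg_map A p@_e * \prod_(i < m) y i ^+ e i.

(** Multiplicativity is transported from the evaluation morphism of multivariate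
polynomials, whose target is a ring with 1 <> 0. *)
Hypothesis A1 : (1 : A) != 0.

Let A' : comNzRingType :=
  HB.pack (GRing.ComPzRing.sort A) (GRing.ComPzRing.on (GRing.ComPzRing.sort A))
    (GRing.PzSemiRing_isNonZero.Build (GRing.ComPzRing.sort A) A1).
Let ev : {rmorphism {mpoly k[m]} -> A'} :=
  mmap (alg_map A : {rmorphism k -> A'}) y.

Lemma pevalD p q : peval (p + q) = peval p + peval q.
Proof. exact: (rmorphD ev). Qed.

Lemma pevalM p q : peval (p * q) = peval p * peval q.
Proof. exact: (rmorphM ev). Qed.

Lemma peval0 : peval 0 = 0.
Proof. exact: (rmorph0 ev). Qed.

Lemma pevalC c : peval c%:MP = alg_map A c.
Proof. exact: (mmapC (y : 'I_m -> A') (alg_map A : {rmorphism k -> A'}) c). Qed.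

Lemma peval_term c e :
  peval (c *: 'X_[e]) = alg_map A c * \prod_(i < m) y i ^+ e i.
Proof.
rewrite -mul_mpolyC pevalM pevalC; congr (_ * _).
exact: (mmapX (y : 'I_m -> A') (alg_map A : {rmorphism k -> A'}) e).
Qed.

End PolynomialEvaluation.

Section SemilinearEvaluation.
Variables (k k' : fieldType) (m : nat) (t : {rmorphism k -> k'}).
Variables (A : algebra k) (A' : algebra k') (f : alg_hom A (restr_scalars t A')).

Lemma peval_semilinear (y : 'I_m -> A) (p : {mpoly k[m]}) :
  (1 : A) != 0 -> (1 : A') != 0 ->
  f (peval y p) = peval (fun r => f (y r) : A') (map_mpoly t p).
Proof.
move=> A1 A'1; elim/mpolyind: p => [|c e p _ _ IH].
  by rewrite raddf0 !peval0 ?rmorph0.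
rewrite raddfD /= !pevalD // rmorphD IH map_mpolyZ map_mpolyX; congr (_ + _).
rewrite !peval_term // rmorphM hom_alg; congr (_ * _).
by rewrite rmorph_prod; apply: eq_bigr => r _; rewrite rmorphXn.
Qed.

End SemilinearEvaluation.

Section FiberMaps.
Variables (n : nat) (k : sigma_field n) (G : algebraic_group k) (i : nat).
Variables (J : set (coord_upto G i)) (J' : set (coord_upto G i.+1)).

Lemma fiber_ideal_incl (t : 'X_{1..n < i.+1}) z :
  coord_incl G i @` J `<=` J' -> fiber_ideal J (below t) z ->
  fiber_ideal J' (below (widen_mon t)) (coord_incl G i z).
Proof.
move=> JJ'; move: z; apply: ideal_gen_min.
  exact: (ideal_preimage (coord_incl G i) (ideal_gen_ideal _)).
move=> z [Jz|[s st [b b0 <-]]].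
  by apply: ideal_gen_sub; left; apply: JJ'; exists z.
apply: ideal_gen_sub; right; exists (widen_mon s); first exact: st.
by exists b => //; rewrite coord_incl_factor.
Qed.

Lemma coord_sigma_augmentation j (s : 'X_{1..n < i.+1}) b :
  counit (hopf_base_change (sigma_act s) G) b = 0 ->
  exists2 b', counit (hopf_base_change (sigma_act (shift_mon j s)) G) b' = 0 &
    coord_sigma G i j (coord_factor G s b) = coord_factor G (shift_mon j s) b'.
Proof.
move=> b0.
have [b' sE] : exists b', coord_sigma G i j (coord_factor G s b) =
    coord_factor G (shift_mon j s) b'.
  have [r ->] := tens2_span b.
  exists (\sum_(p <- r) bc_pure (sigma_act (shift_mon j s)) p.1 (sigma k j p.2)).
  by rewrite !rmorph_sum; apply: eq_bigr => p _; exact: coord_sigmaE.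
exists b' => //.
have [_ <- _] := coord_factor_hopf G (shift_mon j s).
rewrite -sE; have [_ -> _] := coord_sigma_hopf G i j.
have [_ c _] := coord_factor_hopf G s.
by rewrite [X in sigma k j X](c b) b0 rmorph0.
Qed.

(** Multiplication by sigma_j preserves the order of monomials, so trivial
coordinates below t go to trivial coordinates below sigma_j t. *)
Lemma fiber_ideal_sigma j (t : 'X_{1..n < i.+1}) z :
  coord_sigma G i j @` J `<=` J' -> fiber_ideal J (below t) z ->
  fiber_ideal J' (below (shift_mon j t)) (coord_sigma G i j z).
Proof.
move=> JJ'; move: z; apply: ideal_gen_min.
  exact: (ideal_preimage (coord_sigma G i j) (ideal_gen_ideal _)).
move=> z [Jz|[s st [b b0 <-]]].
  by apply: ideal_gen_sub; left; apply: JJ'; exists z.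
have [b' b'0 ->] := coord_sigma_augmentation j b0.
apply: ideal_gen_sub; right; exists (shift_mon j s); last by exists b'.
by rewrite /below /= ltmc_add2r.
Qed.

End FiberMaps.

Lemma peval_linear (k : fieldType) (m : nat) (A A' : algebra k)
    (f : alg_hom A A') (y : 'I_m -> A) (p : {mpoly k[m]}) :
  f (peval y p) = peval (fun r => f (y r)) p.
Proof.
rewrite rmorph_sum; apply: eq_bigr => e _.
rewrite rmorphM hom_alg rmorph_prod; congr (_ * _).
by apply: eq_bigr => r _; rewrite rmorphXn.
Qed.

Section Generators.
Variables (n : nat) (k : sigma_field n) (G : algebraic_group k).
Variables (m : nat) (x : 'I_m -> G).
Hypothesis xP : forall a : G, exists p : {mpoly k[m]}, a = peval x p.

Definition coord_gen i (t : 'X_{1..n < i.+1}) (r : 'I_m) : coord_upto G i :=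
  coord_factor G t (bc_in (sigma_act t) G (x r)).

Lemma coord_factor_peval i (t : 'X_{1..n < i.+1}) b :
  exists p, coord_factor G t b = peval (coord_gen t) p.
Proof.
have P1 := hopf_algebra_neq0 (coord_upto G i).
have [s ->] := tens2_span b; rewrite rmorph_sum.
elim/big_ind: _ => [|_ _ [p ->] [q ->]|[a c] _].
- by exists 0; rewrite peval0.
- by exists (p + q); rewrite pevalD.
have [p ->] := xP a.
exists (map_mpoly (sigma_act t) p * c%:MP); rewrite pevalM // pevalC //.
rewrite rmorphM; congr (_ * _); last exact: (hom_alg (coord_factor G t)).
pose f : alg_hom G (restr_scalars (sigma_act t) (coord_upto G i)) :=
  comp_hom (restr_hom (sigma_act t) (coord_factor G t)) (bc_in (sigma_act t) G).
exact: (peval_semilinear f x p (hopf_algebra_neq0 G) P1).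
Qed.

Lemma coord_incl_peval i (t : 'X_{1..n < i.+1}) p :
  coord_incl G i (peval (coord_gen t) p) = peval (coord_gen (widen_mon t)) p.
Proof.
rewrite peval_linear; congr (peval _ p); apply/funext => r.
exact: coord_incl_factor.
Qed.

Lemma coord_sigma_peval i j (t : 'X_{1..n < i.+1}) p :
  coord_sigma G i j (peval (coord_gen t) p) =
  peval (coord_gen (shift_mon j t)) (map_mpoly (sigma k j) p).
Proof.
have <- : (fun r => coord_sigma G i j (coord_gen t r)) = coord_gen (shift_mon j t).
  by apply/funext => r; exact: coord_sigma_factor.
by apply: (peval_semilinear (A' := coord_upto G i.+1) (coord_sigma G i j));
  exact: hopf_algebra_neq0.
Qed.

Variable (I : forall i, set (coord_upto G i)).

(** Indexed by all exponent vectors u, and empty when the order of u exceeds i. *)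
Definition fiber_polys (i : nat) (u : 'X_{1..n}) : set {mpoly k[m]} :=
  [set p | exists2 t : 'X_{1..n < i.+1}, (t : 'X_{1..n}) = u &
     fiber_ideal (I (i := i)) (below t) (peval (coord_gen t) p)].

End Generators.

(** * Stabilisation *)
Lemma sigma_ideal_hopf (n : nat) (k : sigma_field n) (G : algebraic_group k)
    (i : nat) (J : set (coord_upto G i)) : hopf_ideal J ->
  hopf_ideal (ideal_gen (coord_incl G i @` J `|`
    \bigcup_(j in [set: 'I_n]) (coord_sigma G i j @` J))).
Proof.
move=> JH; apply: hopf_ideal_gen => y [|[j _]].
  apply: (hopf_morphism_stable (coord_incl_hopf G i) JH) => z zJ.
  by apply: ideal_gen_sub; left.
apply: (semi_hopf_stable (coord_sigma_hopf G i j) JH) => z zJ.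
by apply: ideal_gen_sub; right; exists j.
Qed.

Theorem theorem6p4 (n : nat) (n_gt0 : (0 < n)%N) (k : sigma_field n)
    (G : algebraic_group k) (I : forall i : nat, set (coord_upto G i))
    (I_group : generalised_sigma_group I) :
  exists N : nat, forall i : nat, (N <= i)%N ->
    I i.+1 = ideal_gen
      (coord_incl G i @` I i `|`
       \bigcup_(j in [set: 'I_n]) (coord_sigma G i j @` I i)).
Proof.
have [IH Istep] := I_group.
have [m [x xP]] := coord_fg G.
pose A := fiber_polys x I.
have inclA i J (t : 'X_{1..n < i.+1}) p : coord_incl G i @` I i `<=` J ->
    fiber_ideal (I i) (below t) (peval (coord_gen x t) p) ->
    fiber_ideal J (below (widen_mon t)) (peval (coord_gen x (widen_mon t)) p).
  by move=> IJ /(fiber_ideal_incl IJ); rewrite coord_incl_peval.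
have sigmaA i j (J : set (coord_upto G i.+1)) (t : 'X_{1..n < i.+1}) p :
    coord_sigma G i j @` I i `<=` J ->
    fiber_ideal (I i) (below t) (peval (coord_gen x t) p) ->
    fiber_ideal J (below (shift_mon j t))
      (peval (coord_gen x (shift_mon j t)) (map_mpoly (sigma k j) p)).
  by move=> IJ /(fiber_ideal_sigma IJ); rewrite coord_sigma_peval.
have idealA i J (t : 'X_{1..n < i.+1}) :
    is_ideal [set p | fiber_ideal J (below t) (peval (coord_gen x t) p)].
  have P1 := hopf_algebra_neq0 (coord_upto G i).
  have [F0 FD FM] := ideal_gen_ideal (J `|` factor_augmentations (below t)).
  split=> [|p q|p q] /=; rewrite ?peval0 ?pevalD ?pevalM //.
    exact: FD.
  exact: FM.
have [|||||N NP] := @noetherian_family n m k A.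
- move=> i u p q [t tu pF] [s su qF]; exists t => //.
  have st : s = t by apply: val_inj; rewrite /= su tu.
  by have [_ D _] := idealA i (I i) t; apply: D => //; rewrite -st.
- move=> i u p q [t tu qF]; exists t => //.
  by have [_ _ M] := idealA i (I i) t; exact: M.
- by move=> i u p [t <- _]; have := bmdeg t; rewrite ltnS.
- move=> i u p [t tu pF]; exists (widen_mon t) => //.
  by apply: inclA pF; have [] := Istep i.
- move=> i u j p [t tu pF]; exists (shift_mon j t); first by rewrite /= tu.
  by apply: sigmaA pF; have [_] := Istep i.
exists N => i Ni; apply/seteqP; split; last first.
  apply: ideal_gen_min; first by have [] := IH i.+1.
  by have [Ii Is] := Istep i; move=> y [/Ii|[j _ /Is]].
set I' := ideal_gen _.
apply: fiberwise_inclusion => //.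
- exact: sigma_ideal_hopf.
- apply: ideal_gen_min; first by have [] := IH i.+1.
  by have [Ii Is] := Istep i; move=> y [/Ii|[j _ /Is]].
move=> t b; have [p ->] := coord_factor_peval xP b => pI.
apply: (NP i t [set q | fiber_ideal I' (below t) (peval (coord_gen x t) q)]
  Ni (idealA i.+1 I' t) _ _ p) => [q [s su qF]|j s' q ts [s su qF]|].
- have <- : widen_mon s = t by exact: val_inj.
  by apply: inclA qF => y yI; apply: ideal_gen_sub; left.
- have <- : shift_mon j s = t by apply: val_inj; rewrite /= su ts.
  by apply: sigmaA qF => y yI; apply: ideal_gen_sub; right; exists j.
- by exists t.
Qed.
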